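(* Assume (A3), (A4), let $p\in(0,2]$ and $q<\frac p2$, and let $x$ be a bounded trajectory solution of (MTRIGS) with initial data $(x_0,v_0)$. Then, as $t\to+\infty$: (i) $\mathcal E^q_\lambda(t)=O(1)$ for every $0<\lambda<\frac\alpha2$; (ii) $\varphi_t(x(t))=O(t^{-2q})$; (iii) $\varphi(x(t))=O(t^{-2q})$; (iv) $\|x(t)-z(t)\|=O(1)$; (v) $\|\dot x(t)\|=O(t^{-q})$.
   Context: $\mathcal H$ real Hilbert space; $f_1,\dots,f_m:\mathcal H\to\mathbb R$ convex, continuously differentiable with Lipschitz continuous gradients; $F=(f_1,\dots,f_m)^\top$. Weak Pareto optimal: no $x$ with $f_i(x)<f_i(x^* )$ for all $i$; $\mathcal P_w$ the set of such points. $\mathcal L(F,b):=\{x:f_i(x)\le b_i\ \forall i\}$, $\mathcal{LP}_w(F,b):=\mathcal L(F,b)\cap\mathcal P_w$. Merit function $\varphi(x):=\sup_z\min_i(f_i(x)-f_i(z))$. Parameters $t_0>0$, $\alpha,\beta>0$, $q\in(0,1]$, $p\in(0,2]$, initial data $x_0,v_0\in\mathcal H$; $C(x):=\operatorname{conv}\{\nabla f_i(x)\}$. A trajectory solution of (MTRIGS) is $x:[t_0,\infty)\to\mathcal H$, continuously differentiable, with $\dot x$ absolutely continuous on each $[t_0,T]$ and a.e. derivative $\ddot x$ (Bochner measurable, $\dot x(t)=\dot x(t_0)+\int_{t_0}^t\ddot x$), satisfying $\frac{\alpha}{t^q}\dot x(t)+\operatorname{proj}_{C(x(t))+\frac{\beta}{t^p}x(t)+\ddot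 x(t)}(0)=0$ for a.e. $t\ge t_0$, $x(t_0)=x_0$, $\dot x(t_0)=v_0$. (A3): with $a_i:=\frac{\beta}{2t_0^p}\|x_0\|^2+\frac12\|v_0\|^2$, for every $x\in\mathcal L(F,F(x_0)+a)$, $\mathcal{LP}_w(F,F(x))\ne\emptyset$, and $R:=\sup_{F^*\in F(\mathcal{LP}_w(F,F(x_0)+a))}\inf_{z\in F^{-1}(\{F^*\})}\|z\|<\infty$. (A4): $S(w):=\operatorname{argmin}_z\max_i(f_i(z)-w_i)\neq\emptyset$ for all $w\in\mathbb R^m$ and $w\mapsto\operatorname{proj}_{S(w)}(0)$ is continuous. $f_{t,i}(x):=f_i(x)+\frac{\beta}{2t^p}\|x\|^2$; $\varphi_t(x):=\sup_z\min_i(f_{t,i}(x)-f_{t,i}(z))$; $z(t):=\operatorname{argmin}_z\max_i(f_{t,i}(z)-f_{t,i}(x(t)))$. For $r\in[q,1]$ and $\lambda>0$: $\mathcal E^r_\lambda(t):=t^{2r}\varphi_t(x(t))+\frac12\|\lambda(x(t)-z(t))+t^r\dot x(t)\|^2+\frac\lambda2\big(rt^{r-1}+\alpha t^{r-q}-2\lambda\big)\|x(t)-z(t)\|^2$. *)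

(* Defs.v *)
From HB Require Import structures.
From mathcomp Require Import all_boot all_order all_algebra.
From mathcomp Require Import all_classical all_reals all_analysis.
Set Implicit Arguments. Unset Strict Implicit. Unset Printing Implicit Defensive.
Import Order.TTheory GRing.Theory Num.Theory.
Import numFieldNormedType.Exports.
Local Open Scope classical_set_scope.
Local Open Scope ring_scope.

Section Defs.
Context {R : realType} {V : normedModType R}.

Definition inner_product (ip : V -> V -> R) : Prop :=
  (forall x y, ip x y = ip y x) /\
  (forall (a : R) x y z, ip (a *: x + y) z = a * ip x z + ip y z) /\
  (forall x, ip x x = `|x| ^+ 2).

Definition convex_fun (f : V -> R) : Prop :=
  forall x y (a : R), 0 <= a -> a <= 1 ->
    f (a *: x + (1 - a) *: y) <= a * f x + (1 - a) * f y.

Definition gradient_of (ip : V -> V -> R) (f : V -> R) (grad : V -> V) : Prop :=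
  forall x, differentiable f x /\ forall h, 'd f x h = ip (grad x) h.

Definition lipschitz_map (g : V -> V) : Prop :=
  exists L : R, forall x y, `|g x - g y| <= L * `|x - y|.

Definition emax (m : nat) (g : 'I_m -> R) : \bar R :=
  \big[Order.max/-oo%E]_(i < m) (g i)%:E.
Definition emin (m : nat) (g : 'I_m -> R) : \bar R :=
  \big[Order.min/+oo%E]_(i < m) (g i)%:E.

Definition merit (m : nat) (f : 'I_m -> V -> R) (x : V) : \bar R :=
  ereal_sup [set emin (fun i => f i x - f i z) | z in [set: V]].

Definition reg_obj (m : nat) (f : 'I_m -> V -> R) (beta p t : R) : 'I_m -> V -> R :=
  fun i x => f i x + beta / (2 * t `^ p) * `|x| ^+ 2.

Definition argmin_set (m : nat) (f : 'I_m -> V -> R) (w : 'I_m -> R) : set V :=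
  [set z | forall u, (emax (fun i => (f i z - w i)%R) <= emax (fun i => (f i u - w i)%R))%E].

Definition proj0 (S : set V) : V :=
  xget 0 [set w | S w /\ forall y, S y -> `|w| <= `|y|].

(* the (unique) element of a set (used for argmin of a strongly convex function) *)
Definition the_elt (S : set V) : V := xget 0 S.

Definition conv_grads (m : nat) (grad : 'I_m -> V -> V) (x : V) : set V :=
  [set y | exists lam : 'I_m -> R, (forall i, 0 <= lam i) /\
     \sum_(i < m) lam i = 1 /\ y = \sum_(i < m) lam i *: grad i x].

Definition level_set (m : nat) (f : 'I_m -> V -> R) (b : 'I_m -> R) : set V :=
  [set x | forall i, f i x <= b i].
Definition weak_pareto (m : nat) (f : 'I_m -> V -> R) : set V :=
  [set x | ~ exists y, forall i, f i y < f i x].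
Definition LPw (m : nat) (f : 'I_m -> V -> R) (b : 'I_m -> R) : set V :=
  level_set f b `&` weak_pareto f.

Definition assumption_A3 (m : nat) (f : 'I_m -> V -> R) (beta p t0 : R) (x0 v0 : V) : Prop :=
  let a : 'I_m -> R := fun _ => beta / (2 * t0 `^ p) * `|x0| ^+ 2 + 2^-1 * `|v0| ^+ 2 in
  let b0 : 'I_m -> R := fun i => f i x0 + a i in
  (forall x, level_set f b0 x -> LPw f (fun i => f i x) !=set0) /\
  (ereal_sup [set ereal_inf [set (`|z|)%:E | z in [set z | forall i, f i z = f i y]]
              | y in LPw f b0] < +oo)%E.

Definition assumption_A4 (m : nat) (f : 'I_m -> V -> R) : Prop :=
  (forall w : 'I_m -> R, argmin_set f w !=set0) /\
  (forall (w : 'I_m -> R) (eps : R), 0 < eps -> exists2 delta : R, 0 < delta &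
     forall w' : 'I_m -> R, (forall i, `|w' i - w i| < delta) ->
       `|proj0 (argmin_set f w') - proj0 (argmin_set f w)| < eps).

Definition abs_cont_on (g : R -> V) (a b : R) : Prop :=
  forall eps : R, 0 < eps -> exists2 delta : R, 0 < delta &
    forall (n : nat) (l r : nat -> R),
      (forall k, (k < n)%N -> a <= l k /\ l k <= r k /\ r k <= b) ->
      (forall j k, (j < k)%N -> (k < n)%N -> r j <= l k) ->
      \sum_(k < n) (r k - l k) < delta ->
      \sum_(k < n) `|g (r k) - g (l k)| < eps.

Definition mtrigs_solution (m : nat) (grad : 'I_m -> V -> V)
    (alpha beta p q t0 : R) (x0 v0 : V) (x xd xdd : R -> V) : Prop :=
  x t0 = x0 /\ xd t0 = v0 /\
  (forall t, t0 < t -> is_derive t 1 x (xd t)) /\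
  ((fun h : R => h^-1 *: (x (t0 + h) - x t0)) @ at_right 0 --> xd t0) /\
  {within `[t0, +oo[, continuous xd} /\
  (forall T, t0 <= T -> abs_cont_on xd t0 T) /\
  {ae (@lebesgue_measure R), forall t, t0 < t -> is_derive t 1 xd (xdd t)} /\
  {ae (@lebesgue_measure R), forall t, t0 <= t ->
     alpha / t `^ q *: xd t
     + proj0 [set y + (beta / t `^ p) *: x t + xdd t | y in conv_grads grad (x t)]
     = 0}.

Definition zpath (m : nat) (f : 'I_m -> V -> R) (beta p : R) (x : R -> V) (t : R) : V :=
  the_elt (argmin_set (reg_obj f beta p t) (fun i => reg_obj f beta p t i (x t))).

Definition energy (m : nat) (f : 'I_m -> V -> R) (alpha beta p q r lam : R)
    (x xd : R -> V) (t : R) : \bar R :=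
  let z := zpath f beta p x t in
  ((t `^ (2 * r))%:E * merit (reg_obj f beta p t) (x t)
   + (2^-1 * `|lam *: (x t - z) + t `^ r *: xd t| ^+ 2
      + lam / 2 * (r * t `^ (r - 1) + alpha * t `^ (r - q) - 2 * lam)
        * `|x t - z| ^+ 2)%:E)%E.

End Defs.

(* Main.v *)
(** The regularized energies W_i = f_i(x) + beta/(2 t^p) |x|^2 + |x'|^2/2 are nonincreasing, by
the variational inequality of the projection defining the flow.  Fix a time T.  By (A3), any
competitor y with F(y) <= F(x(T)) may be replaced by some z with F(z) <= F(y) and |z| <= Z,
where Z does not depend on T; monotonicity gives W_i(t) >= f_i(z) for all t <= T.  For this
fixed z consider the minimum over i of

  G_i(t) = t^(2q) (W_i(t) - f_i(z)) + (alpha/3) t^q <x(t) - z, x'(t)>.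

Since x is bounded and t^(2q) beta/t^p <= beta, every active G_i is nonincreasing wherever it
exceeds a constant that depends only on Z and the bound on x.  So G is bounded at time T
uniformly in T, which bounds both t^q |x'(t)| and t^(2q) phi(x(t)).  Freezing z, rather than
following z(t) as the energy of the statement does, avoids differentiating z(t), which is only
Hölder continuous in general.  The minimizer z(t) itself is bounded by Z, again by (A3), and
the remaining bounds follow.  If the minimum defining z(t) were not attained, [zpath] would
be 0, and the bounds would still hold. *)

Require Import Defs.
From HB Require Import structures.
From mathcomp Require Import all_boot all_order all_algebra.
From mathcomp Require Import all_classical all_reals all_analysis.
From mathcomp Require Import measurable_realfun.
From mathcomp Require Import ring lra.
Import Order.TTheory GRing.Theory Num.Theory.
Import numFieldNormedType.Exports.
Local Open Scope classical_set_scope.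
Local Open Scope ring_scope.

Set Implicit Arguments.
Unset Strict Implicit.
Unset Printing Implicit Defensive.

(** * Growth of functions with absolutely continuous increments *)

(** The supremum [c] of the points where [P] holds cannot lie below [b]. The step straddles [t]: it
    carries [P] from points left of [c] to [c] and beyond, so no separate closedness condition is
    asked for. *)
Lemma real_induction (R : realType) (P : R -> Prop) (a b : R) : a <= b -> P a ->
  (forall t, a <= t -> t <= b -> exists2 d : R, 0 < d &
     forall u v, a <= u -> u <= t -> t <= v -> v <= b ->
       t - d < u -> v < t + d -> P u -> P v) -> P b.
Proof.
move=> ab Pa step.
pose S := [set c | [/\ a <= c, c <= b & P c]].
have Sa : S a by split.
have ubS : has_ubound S by exists b => c [].
have supS : has_sup S by split; [exists a|].
set c := sup S.
have ac : a <= c by apply: ub_le_sup.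
have cb : c <= b by apply: sup_le_ub; [exists a|move=> y []].
have [d d0 H] := step c ac cb.
have [u [au ub Pu] cdu] := sup_adherent d0 supS.
have uc : u <= c by apply: ub_le_sup.
have [bcd|bcd] := leP b (c + d / 2).
  by apply: (H u b) => //; lra.
have Pv : P (c + d / 2) by apply: (H u) => //; lra.
have : c + d / 2 <= c by apply: ub_le_sup => //; split => //; lra.
by move=> ?; exfalso; lra.
Qed.

Lemma negligible_open_cover (R : realType) (N : set R) (e : R) :
  (@lebesgue_measure R).-negligible N -> 0 < e ->
  exists U : set R, [/\ open U, N `<=` U & (lebesgue_measure U < e%:E)%E].
Proof.
move=> [A [mA A0 NA]] e0.
have Afin : (lebesgue_measure A < +oo)%E by rewrite A0 ltry.
have [U [oU AU mU]] := lebesgue_regularity_outer mA Afin e0.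
exists U; split => //; first exact: subset_trans NA AU.
have mU' : measurable U by exact: open_measurable.
have : lebesgue_measure U = (lebesgue_measure (U `\` A) + lebesgue_measure A)%E.
  rewrite -measureU //; last 2 first.
  - exact: measurableD.
  - by rewrite setDE -setIA setICl setI0.
  by congr (lebesgue_measure _); rewrite setUC setDUK.
by move=> ->; rewrite A0 adde0.
Qed.

Section ac_increment.
Context {R : realType} {V : normedModType R}.

(* Ordered intervals [[l k, r k]] in [[a, c]], placed so that their total length is at most the
   measure of [U] there. *)
Record interval_family (U : set R) (a c : R) (n : nat) (l r : nat -> R) : Prop := IntervalFamily {
  interval_family_in : forall k, (k < n)%N -> a <= l k /\ l k <= r k /\ r k <= c;
  interval_family_ord : forall j k, (j < k)%N -> (k < n)%N -> r j <= l k;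
  interval_family_mes : ((\sum_(k < n) (r k - l k))%:E <= lebesgue_measure (U `&` `[a, c]))%E }.

Lemma interval_family_le (U : set R) (a c c' : R) n l r : open U -> c <= c' ->
  interval_family U a c n l r -> interval_family U a c' n l r.
Proof.
move=> oU cc' [H1 H2 H3]; split => //.
  by move=> k /H1[? [? ?]]; split => //; split => //; lra.
apply: le_trans H3 _; apply: le_measure; rewrite ?inE.
- by apply: measurableI => //; exact: open_measurable.
- by apply: measurableI => //; exact: open_measurable.
- apply: setIS => x /=; rewrite !in_itv /= => /andP[-> ?] /=; lra.
Qed.

Lemma interval_family_extend (U : set R) (a u v : R) n l r : open U -> a <= u -> u <= v ->
  `[u, v] `<=` U -> interval_family U a u n l r ->
  interval_family U a v n.+1 (fun k => if (k < n)%N then l k else u)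
                 (fun k => if (k < n)%N then r k else v).
Proof.
move=> oU au uv uvU [H1 H2 H3]; split => //.
- move=> k; rewrite ltnS leq_eqVlt => /orP[/eqP->|kn].
    by rewrite ltnn; split => //; split.
  by rewrite kn; have [? [? ?]] := H1 k kn; split => //; split => //; lra.
- move=> j k jk; rewrite ltnS leq_eqVlt => /orP[/eqP kn|kn].
    by subst k; rewrite jk ltnn; have [? []] := H1 j jk.
  by rewrite kn (ltn_trans jk kn); exact: H2.
- rewrite big_ord_recr /= ltnn.
  under eq_bigr do rewrite ltn_ord.
  rewrite EFinD.
  have mU : measurable U by exact: open_measurable.
  (* The left end is dropped so that the new piece is disjoint from [[a, u]] and the measures
     add. *)
  have -> : ((v - u)%:E = lebesgue_measure (`]u, v] : set R))%E.
    by rewrite lebesgue_measure_itv /= lte_fin; case: ltP => // ?; congr EFin; lra.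
  apply: le_trans (leeD H3 (lexx _)) _.
  rewrite -measureU //; last 2 first.
  - exact: measurableI.
  - rewrite -subset0 => x /= [[_]]; rewrite !in_itv /= => /andP[_ xu] /andP[ux _].
    by move: (lt_le_trans ux xu); rewrite ltxx.
  apply: le_measure; rewrite ?inE.
  + by apply: measurableU => //; exact: measurableI.
  + exact: measurableI.
  + move=> x /= [[Ux]|]; rewrite !in_itv /= => /andP[? ?].
      by split => //; apply/andP; split; lra.
    split; last by apply/andP; split; lra.
    by apply: uvU; rewrite /= in_itv /=; apply/andP; split; lra.
Qed.

(* A fundamental theorem of calculus in the form needed for Lyapunov functions:
   off a null set the increments of [g] are locally bounded by [e] times the length,
   and the remaining increments are controlled by those of an absolutely continuous
   function.  Real induction replaces Cousin's partition lemma. *)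
Lemma ac_increment_le (w : R -> V) (g : R -> R) (a b K : R) (N : set R) :
  a <= b -> 0 <= K -> abs_cont_on w a b ->
  (forall u v, a <= u -> u <= v -> v <= b ->
     g v - g u <= K * ((v - u) + `|w v - w u|)) ->
  (@lebesgue_measure R).-negligible N ->
  (forall t, a <= t -> t <= b -> ~ N t -> forall e : R, 0 < e -> exists2 d : R, 0 < d &
     forall u v, a <= u -> u <= t -> t <= v -> v <= b ->
       t - d < u -> v < t + d -> g v - g u <= e * (v - u)) ->
  g b <= g a.
Proof.
move=> ab K0 ac gK N0 gN.
(* The slope [e] outside the null set costs [e * (b - a)]; the intervals covering the null set have
   total length and total [w]-increment below [e] each, hence [2 * K]. *)
suff H : forall e : R, 0 < e -> g b <= g a + e * ((b - a) + 2 * K).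
  apply/ler_addgt0Pr => e e0.
  have D0 : 0 < (b - a) + 2 * K + 1 by lra.
  have := H (e / ((b - a) + 2 * K + 1)) (divr_gt0 e0 D0).
  move=> /le_trans; apply; rewrite lerD2l -mulrA ler_piMr //; first exact: ltW.
  rewrite mulrC ler_pdivrMr //; lra.
move=> e e0.
have [de de0 acd] := ac e e0.
(* [de] triggers absolute continuity of [w], while [e] bounds the total length itself. *)
have me0 : 0 < Num.min de e by rewrite lt_min de0.
have [U [oU NU mU]] := negligible_open_cover N0 me0.
pose P c := exists n l r, interval_family U a c n l r /\
  g c <= g a + e * (c - a) + K * \sum_(k < n) ((r k - l k) + `|w (r k) - w (l k)|).
have : P b.
  apply: (real_induction ab).
    exists 0%N, (fun=> a), (fun=> a); split.
      by split => //; rewrite big_ord0 measure_ge0.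
    by rewrite big_ord0; lra.
  (* Off [N] the family is kept and the slope [e] pays for the step. On [N] the interval [[u, v]],
     contained in [U], is appended to the family. *)
  move=> t ta tb; have [Nt|Nt] := pselect (N t); last first.
    have [d d0 Hd] := gN t ta tb Nt e e0.
    exists d => // u v au ut tv vb du dv [n [l [r [F gu]]]].
    exists n, l, r; split; first by apply: interval_family_le F => //; lra.
    have := Hd u v au ut tv vb du dv; lra.
  have /nbhs_ballP[d /= d0 dU] : nbhs t U by apply: open_nbhs_nbhs; split => //; exact: NU.
  exists d => // u v au ut tv vb du dv [n [l [r [F gu]]]].
  exists n.+1, (fun k => if (k < n)%N then l k else u), (fun k => if (k < n)%N then r k else v).
  split.
    apply: interval_family_extend => //; first lra.
    move=> x /=; rewrite in_itv /= => /andP[ux xv]; apply: dU.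
    by rewrite /ball /= ltr_norml; apply/andP; split; lra.
  rewrite big_ord_recr /= ltnn.
  under eq_bigr do rewrite ltn_ord.
  have uv : u <= v by lra.
  have := gK u v au uv vb; rewrite mulrDr.
  have : e * (u - a) <= e * (v - a) by rewrite ler_pM2l //; lra.
  lra.
move=> [n [l [r [[H1 H2 H3] gb]]]].
have S1 : \sum_(k < n) (r k - l k) < Num.min de e.
  rewrite -lte_fin; apply: le_lt_trans mU; apply: le_trans H3 _.
  have mU' : measurable U by exact: open_measurable.
  by apply: le_measure; rewrite ?inE //; exact: measurableI.
move: (S1); rewrite lt_min => /andP[S2 S3].
have := acd n l r H1 H2 S2 => S4.
apply: le_trans gb _; rewrite big_split /=.
have : K * (\sum_(i < n) (r i - l i) + \sum_(i < n) `|w (r i) - w (l i)|) <= K * (2 * e).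
  by apply: ler_wpM2l => //; lra.
lra.
Qed.

End ac_increment.

(** * Derivatives and inner products *)

Section derivative_quotients.
Context {R : realType} {W : normedModType R}.

Lemma is_deriveP (f : R -> W) (t : R) (d : W) :
  is_derive t 1 f d <-> (fun h : R => h^-1 *: (f (t + h) - f t)) @ 0^' --> d.
Proof.
have E : (fun h : R => h^-1 *: ((f \o shift t) (h *: (1 : R)) - f t)) =
         (fun h : R => h^-1 *: (f (t + h) - f t)).
  by apply/funext => h /=; rewrite [h *: 1]mulr1 (addrC h t).
split=> [[fx <-]|H].
  by move: fx; rewrite /derivable /derive E; exact.
by split; rewrite /derivable /derive E; [apply/cvg_ex; exists d|exact: cvg_lim].
Qed.

Lemma is_derive_eps (f : R -> W) (t : R) (d : W) (e : R) :
  is_derive t 1 f d -> 0 < e -> exists2 r : R, 0 < r &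
    forall s, `|s - t| < r -> `|f s - f t - (s - t) *: d| <= e * `|s - t|.
Proof.
move=> /is_deriveP/cvgrPdist_lt H e0.
have /nbhs_ballP[r /= r0 Hr] := H e e0; exists r => // s sr.
have [->|st] := eqVneq s t; first by rewrite !subrr scale0r subrr !normr0 mulr0.
have st0 : s - t != 0 by rewrite subr_eq0.
have := Hr (s - t); rewrite /ball /= sub0r normrN => /(_ sr st0).
rewrite (addrC t) subrK => /ltW Hd.
have -> : f s - f t - (s - t) *: d = (s - t) *: ((s - t)^-1 *: (f s - f t) - d).
  by rewrite scalerBr scalerA divff // scale1r.
by rewrite normrZ mulrC distrC; apply: ler_wpM2r.
Qed.

(** Subtracts the first-order expansions at [t] towards [v] and [u]. With [t] between them, the
    errors [v - t] and [t - u] add up to [v - u], the form that real induction consumes. *)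
Lemma is_derive_increment (f : R -> W) (t : R) (d : W) (e : R) :
  is_derive t 1 f d -> 0 < e -> exists2 r : R, 0 < r &
    forall u v, u <= t -> t <= v -> t - r < u -> v < t + r ->
      `|f v - f u - (v - u) *: d| <= e * (v - u).
Proof.
move=> fd e0; have [r r0 H] := is_derive_eps fd e0; exists r => // u v ut tv ur vr.
have Hv : `|f v - f t - (v - t) *: d| <= e * (v - t).
  by rewrite -[X in e * X](@ger0_norm _ (v - t)) ?subr_ge0 //; apply: H; rewrite ltr_norml; lra.
have Hu : `|f u - f t - (u - t) *: d| <= e * (t - u).
  rewrite -[X in e * X](@ger0_norm _ (t - u)) ?subr_ge0 // (distrC t u).
  by apply: H; rewrite ltr_norml; lra.
have -> : f v - f u - (v - u) *: d = (f v - f t - (v - t) *: d) - (f u - f t - (u - t) *: d).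
  have S (a b c p q : W) : (a - c - p) - (b - c - q) = (a - b) - (p - q).
    by rewrite opprD addrACA -opprD opprB addrA subrK.
  by rewrite S -scalerBl; congr (_ - _ *: _); ring.
apply: le_trans (ler_normB _ _) _.
have -> : e * (v - u) = e * (v - t) + e * (t - u) by ring.
exact: lerD.
Qed.

End derivative_quotients.

Section inner_product_theory.
Context {R : realType} {V : normedModType R} (ip : V -> V -> R).
Hypothesis hip : inner_product ip.

Lemma ipC x y : ip x y = ip y x. Proof. by case: hip. Qed.
Lemma ipxx x : ip x x = `|x| ^+ 2. Proof. by case: hip => _ []. Qed.
Lemma ipZDl a x y z : ip (a *: x + y) z = a * ip x z + ip y z.
Proof. by case: hip => _ []. Qed.
Lemma ipDl x y z : ip (x + y) z = ip x z + ip y z.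
Proof. by have := ipZDl 1 x y z; rewrite scale1r mul1r. Qed.
Lemma ip0l z : ip 0 z = 0.
Proof. by have := ipDl 0 0 z; rewrite addr0; lra. Qed.
Lemma ipZl a x z : ip (a *: x) z = a * ip x z.
Proof. by have := ipZDl a x 0 z; rewrite addr0 ip0l addr0. Qed.
Lemma ipNl x z : ip (- x) z = - ip x z.
Proof. by rewrite -scaleN1r ipZl mulN1r. Qed.
Lemma ipBl x y z : ip (x - y) z = ip x z - ip y z.
Proof. by rewrite ipDl ipNl. Qed.
Lemma ipDr x y z : ip x (y + z) = ip x y + ip x z.
Proof. by rewrite ipC ipDl !(ipC x). Qed.
Lemma ipZr a x z : ip x (a *: z) = a * ip x z.
Proof. by rewrite ipC ipZl ipC. Qed.
Lemma ipNr x z : ip x (- z) = - ip x z.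
Proof. by rewrite ipC ipNl ipC. Qed.
Lemma ipBr x y z : ip x (y - z) = ip x y - ip x z.
Proof. by rewrite ipDr ipNr. Qed.
Lemma ip0r z : ip z 0 = 0.
Proof. by rewrite ipC ip0l. Qed.
Lemma ip_suml m (a : 'I_m -> R) (g : 'I_m -> V) z :
  ip (\sum_(i < m) a i *: g i) z = \sum_(i < m) a i * ip (g i) z.
Proof.
elim/big_ind2: _ => //; first exact: ip0l.
- by move=> x1 y1 x2 y2 <- <-; rewrite ipDl.
- by move=> i _; rewrite ipZl.
Qed.

(** Cauchy-Schwarz, from the squared norm of the component of [x] orthogonal to [y]. *)
Lemma norm_ip_le x y : `|ip x y| <= `|x| * `|y|.
Proof.
have [->|y0] := eqVneq y 0; first by rewrite ip0r !normr0 mulr0.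
have ny : 0 < `|y| by rewrite normr_gt0.
rewrite -(@ler_pXn2r _ 2%N) ?nnegrE ?mulr_ge0 // real_normK ?num_real //.
have /= H : 0 <= `|x - (ip x y / `|y| ^+ 2) *: y| ^+ 2 by exact: sqr_ge0.
move: H; rewrite -ipxx !(ipBl, ipBr, ipZl, ipZr) !ipxx (ipC y x).
set c := ip x y; set n := `|y| in ny *; set k := `|x|.
have n0 : n != 0 by rewrite gt_eqF.
move=> H; have : 0 <= (k ^+ 2 * n ^+ 2 - c ^+ 2) / n ^+ 2.
  by apply: le_trans H _; rewrite le_eqVlt; apply/orP; left; apply/eqP; field.
by rewrite pmulr_lge0 ?invr_gt0 ?exprn_gt0 // subr_ge0 exprMn.
Qed.

Lemma ip_le x y : ip x y <= `|x| * `|y|.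
Proof. exact: le_trans (ler_norm _) (norm_ip_le x y). Qed.

Lemma ip_ge x y : - (`|x| * `|y|) <= ip x y.
Proof. by have := norm_ip_le x y; rewrite ler_norml => /andP[]. Qed.

Lemma cvg_ip (T : Type) (F : set_system T) {FF : Filter F} (u v : T -> V) a b :
  u @ F --> a -> v @ F --> b -> (fun t => ip (u t) (v t)) @ F --> ip a b.
Proof.
move=> ua vb; apply/cvgrPdistC_lt => e e0.
have c0 : 0 < `|a| + `|b| + 1 by rewrite ltr_wpDl ?addr_ge0.
(* Since [d <= 1], the bilinear error is at most [d * (d + |a| + |b|) <= e]. *)
pose d := Num.min 1 (e / (`|a| + `|b| + 1)).
have d0 : 0 < d by rewrite lt_min ltr01 divr_gt0.
have d1 : d <= 1 by rewrite ge_min lexx.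
have de : d * (`|a| + `|b| + 1) <= e by rewrite -ler_pdivlMr // ge_min lexx orbT.
have /cvgrPdistC_lt/(_ _ d0) Hu := ua.
have /cvgrPdistC_lt/(_ _ d0) Hv := vb.
near=> t.
have tu : `|u t - a| < d by near: t.
have tv : `|v t - b| < d by near: t.
have -> : ip (u t) (v t) - ip a b = ip (u t - a) (v t - b) + ip (u t - a) b + ip a (v t - b).
  by rewrite !(ipBl, ipBr); ring.
apply: le_lt_trans (ler_normD _ _) _; apply: le_lt_trans (lerD (ler_normD _ _) (lexx _)) _.
apply: le_lt_trans (lerD (lerD (norm_ip_le _ _) (norm_ip_le _ _)) (norm_ip_le _ _)) _.
apply: lt_le_trans de.
have h1 : `|u t - a| * `|v t - b| < d * 1 by apply: ltr_pM => //; lra.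
have h2 : `|u t - a| * `|b| <= d * `|b| by apply: ler_wpM2r => //; exact: ltW.
have h3 : `|a| * `|v t - b| <= d * `|a| by rewrite mulrC; apply: ler_wpM2r => //; exact: ltW.
nra.
Unshelve. all: by end_near. Qed.

Lemma is_derive_ip (u v : R -> V) (t : R) (du dv : V) :
  is_derive t 1 u du -> is_derive t 1 v dv ->
  is_derive t 1 (fun s => ip (u s) (v s)) (ip du (v t) + ip (u t) dv).
Proof.
move=> ud vd; apply/is_deriveP.
have vc : (fun h : R => v (t + h)) @ 0^' --> v t.
  have : {for t, continuous v} by apply: differentiable_continuous; apply/derivable1_diffP.
  move=> /cvgrPdist_lt vc; apply/cvgrPdist_lt => e e0.
  have /nbhs_ballP[r /= r0 Hr] := vc e e0.
  exists r => // h /=; rewrite sub0r normrN => hr _; apply: Hr.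
  by rewrite /ball /= opprD addrA subrr sub0r normrN.
have H := cvgD (cvg_ip (proj1 (is_deriveP u t du) ud) vc)
   (cvg_ip (cvg_cst (u t)) (proj1 (is_deriveP v t dv) vd)).
rewrite (_ : (fun h : R => _) = (fun h : R => ip (h^-1 *: (u (t + h) - u t)) (v (t + h)))
  \+ (fun h : R => ip (u t) (h^-1 *: (v (t + h) - v t)))); first exact: H.
apply/funext => h.
by rewrite /= !ipZl !ipZr !ipBl !ipBr /GRing.scale /=; ring.
Qed.

Lemma gradient_chain (f : V -> R) (grad : V -> V) (x : R -> V) (t : R) (dx : V) :
  gradient_of ip f grad -> is_derive t 1 x dx ->
  is_derive t 1 (f \o x) (ip (grad (x t)) dx).
Proof.
move=> fg xd.
have [df dfE] := fg (x t).
have dx' : differentiable x t by apply/derivable1_diffP; case: xd.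
have dc : differentiable (f \o x) t by exact: differentiable_comp.
split; first by apply/derivable1_diffP.
have xdE : 'd x t 1 = dx by rewrite -deriveE //; case: xd.
by rewrite deriveE // diff_comp //= xdE dfE.
Qed.

(** Along the segment from [x] to [y], convexity bounds every right difference quotient by
    [f y - f x]; the directional derivative is their limit. *)
Lemma convex_gradient_le (f : V -> R) (grad : V -> V) (x y : V) :
  convex_fun f -> gradient_of ip f grad -> f x + ip (grad x) (y - x) <= f y.
Proof.
move=> fc fg.
have xd : is_derive (0 : R) 1 (fun s : R => x + s *: (y - x)) (y - x).
  apply/is_deriveP; rewrite (_ : (fun h : R => _) = (fun h : R => (h^-1 * h) *: (y - x))).
    have H : (fun h : R => (1 : R) *: (y - x)) @ 0^' --> y - x.
      by rewrite scale1r; exact: cvg_cst.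
    apply: cvg_trans H; apply: near_eq_cvg; near=> h; rewrite mulVf //.
    by near: h; exact: nbhs_dnbhs_neq.
  by apply/funext => h; rewrite scale0r addr0 add0r addrC addKr scalerA.
have := gradient_chain fg xd; rewrite scale0r addr0 => /is_deriveP /cvg_dnbhs_at_right H.
rewrite addrC -lerBrDr -(cvg_lim _ H) //; apply: limr_le.
  by apply/cvg_ex; exists (ip (grad x) (y - x)).
near=> h.
have h0 : 0 < h by [].
have h1 : h <= 1 by near: h; apply: nbhs_right_le.
rewrite /= add0r scale0r addr0 /GRing.scale /= mulrC ler_pdivrMr //.
have := fc y x h (ltW h0) h1.
have -> : h *: y + (1 - h) *: x = x + h *: (y - x).
  by rewrite scalerBl scale1r scalerBr addrC -addrA; congr (_ + _); rewrite addrC.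
lra.
Unshelve. all: by end_near. Qed.

Lemma gradient_dist (f : V -> R) (grad : V -> V) (x y : V) :
  convex_fun f -> gradient_of ip f grad -> f x - f y <= `|grad x| * `|x - y|.
Proof.
move=> fc fg; have := convex_gradient_le x y fc fg.
by have := ip_le (grad x) (x - y); rewrite -(opprB x y) ipNr; lra.
Qed.

End inner_product_theory.

(** * Minimal-norm element of a convex hull *)

Lemma continuous_lincomb (R : realType) (V : normedModType R) m (G : 'I_m -> V) :
  continuous (fun v : 'rV[R]_m => \sum_(i < m) v ord0 i *: G i).
Proof.
move=> v; apply: cvg_big; [exact: add_continuous|exact: nbhs_filter|].
move=> i _; have H : (fun u : 'rV[R]_m => u ord0 i) @ nbhs v --> v ord0 i.
  exact: coord_continuous.
exact: (@cvgZr_tmp _ _ _ _ (nbhs_filter v) _ _ (G i) H).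
Qed.

Section simplex_projection.
Context {R : realType} {V : normedModType R}.

(** The norm is minimized over the coefficients: the simplex is compact in the finite-dimensional
    coefficient space, whatever the dimension of [V]. *)
Lemma conv_min_norm m (G : 'I_m -> V) (c : V) : (0 < m)%N ->
  exists lam : 'I_m -> R, [/\ forall i, 0 <= lam i, \sum_(i < m) lam i = 1 &
    forall mu : 'I_m -> R, (forall i, 0 <= mu i) -> \sum_(i < m) mu i = 1 ->
      `|\sum_(i < m) lam i *: G i + c| <= `|\sum_(i < m) mu i *: G i + c|].
Proof.
move=> m0; pose s (v : 'rV[R]_m) : R := \sum_(i < m) v ord0 i *: (1 : R^o).
have sE v : s v = \sum_(i < m) v ord0 i by apply: eq_bigr => i _; exact: mulr1.
pose K := [set v : 'rV[R]_m | forall i, `[0, 1]%classic (v ord0 i)] `&` s @^-1` [set 1].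
have Kc : compact K.
  apply: compact_closedI.
    by apply: (@rV_compact R _ (fun=> `[0, 1]%classic)) => _; exact: segment_compact.
  apply: closed_comp; last exact: closed_eq.
  by move=> v _; exact: (@continuous_lincomb R R^o m (fun=> 1 : R^o) v).
pose phi (v : 'rV[R]_m) := `|\sum_(i < m) v ord0 i *: G i + c|.
have phic : continuous phi.
  move=> v; have FF : Filter (nbhs v) by exact: nbhs_filter.
  exact: (cvg_norm (cvgD (@continuous_lincomb R V m G v) (cvg_cst c))).
have simplexK (mu : 'I_m -> R) : (forall i, 0 <= mu i) -> \sum_(i < m) mu i = 1 ->
    K (\row_i mu i).
  move=> mu0 mu1; split; last by rewrite /= sE -[RHS]mu1; apply: eq_bigr => i _; rewrite mxE.
  move=> i /=; rewrite in_itv /= mxE mu0 /= -mu1 (bigD1 i) //= lerDl.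
  by apply: sumr_ge0 => j _.
have Kn : K !=set0.
  exists (\row_i (i == Ordinal m0)%:R); apply: simplexK => [i|].
    by case: (_ == _).
  by rewrite (bigD1 (Ordinal m0)) //= big1 ?addr0 // => i /negbTE ->.
have [v /set_mem[v01 v1] vmin] := EVT_min_rV Kn Kc (continuous_subspaceT phic).
exists (fun i => v ord0 i); split.
- by move=> i; have := v01 i; rewrite /= in_itv /= => /andP[].
- by rewrite -sE.
- move=> mu mu0 mu1; have := vmin (\row_i mu i) (mem_set (simplexK _ mu0 mu1)).
  have E : \sum_(i < m) (\row_i mu i) ord0 i *: G i = \sum_(i < m) mu i *: G i.
    by apply: eq_bigr => i _; rewrite mxE.
  by rewrite /phi E.
Qed.

Context {ip : V -> V -> R} (hip : inner_product ip).

(** Expanding the square along the segment and dividing by [s] gives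
    [0 <= 2 <w, y - w> + s |y - w|^2]; then [s] is taken small. *)
Lemma min_norm_variational (w y : V) :
  (forall s : R, 0 <= s -> s <= 1 -> `|w| <= `|w + s *: (y - w)|) -> ip w w <= ip w y.
Proof.
move=> H; apply/ler_addgt0Pr => e e0.
set d := y - w in H *; pose k := `|d| ^+ 2; have k0 : 0 <= k by exact: sqr_ge0.
pose s := Num.min 1 (e / (k + 1)).
have k1 : 0 < k + 1 by lra.
have s0 : 0 < s by rewrite lt_min ltr01 divr_gt0.
have s1 : s <= 1 by rewrite ge_min lexx.
have sk : s * (k + 1) <= e by rewrite -ler_pdivlMr // ge_min lexx orbT.
have := H s (ltW s0) s1.
rewrite -(@ler_pXn2r _ 2%N) ?nnegrE // -!(ipxx hip) (ipDl hip) !(ipDr hip).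
rewrite !(ipZl hip) !(ipZr hip) (ipC hip d w) (ipxx hip d) -/k.
move=> Hs; have : 0 <= s * (2 * ip w d + s * k) by nra.
rewrite pmulr_rge0 // /d (ipBr hip) => ?; nra.
Qed.

(** Existence of a minimizer ensures that [proj0] is not its default value 0. The variational
    inequality is needed only against the vertices of the hull. *)
Lemma proj0_conv_grads m (grad : 'I_m -> V -> V) (x a b : V) : (0 < m)%N ->
  let w := proj0 [set y + a + b | y in conv_grads grad x] in
  exists lam : 'I_m -> R, [/\ forall i, 0 <= lam i, \sum_(i < m) lam i = 1,
    w = \sum_(i < m) lam i *: grad i x + a + b &
    forall i, ip w w <= ip w (grad i x + a + b)].
Proof.
move=> m0 w; set S := [set y + a + b | y in conv_grads grad x] in w *.
have [lam [l0 l1 lmin]] := conv_min_norm (grad ^~ x) (a + b) m0.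
have [[_ [mu [mu0 [mu1 ->]]] <-] wmin] : S w /\ forall y, S y -> `|w| <= `|y|.
  apply: (@xgetPex _ 0 [set w | S w /\ forall y, S y -> `|w| <= `|y|]).
  exists (\sum_(i < m) lam i *: grad i x + a + b); split.
    by exists (\sum_(i < m) lam i *: grad i x) => //; exists lam.
  move=> _ [_ [mu [mu0 [mu1 ->]]] <-]; rewrite -!addrA; exact: lmin.
exists mu; split => // i; apply: min_norm_variational => s s0 s1; apply: wmin.
(* Weights of the point at parameter [s] on the segment from the projection to vertex [i]. *)
pose nu j := (1 - s) * mu j + s * (j == i)%:R.
exists (\sum_(j < m) nu j *: grad j x).
  exists nu; split; last split => //.
    by move=> j; rewrite addr_ge0 // mulr_ge0 //; lra.
  rewrite big_split /= -!mulr_sumr mu1 (bigD1 i) //= eqxx big1 ?addr0.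
    by rewrite !mulr1 subrK.
  by move=> j /negbTE ->.
rewrite /nu; under eq_bigr do rewrite scalerDl -!scalerA.
have E : \sum_(j < m) (j == i)%:R *: grad j x = grad i x.
  rewrite (bigD1 i) //= eqxx scale1r big1 ?addr0 // => j /negbTE ->.
  by rewrite scale0r.
rewrite big_split /= -!scaler_sumr E.
set y := \sum_(j < m) _.
have -> : grad i x + a + b - (y + a + b) = grad i x - y.
  by rewrite opprD addrACA subrr addr0 opprD addrACA subrr addr0.
rewrite scalerBl scale1r scalerBr -(addrA y (- _)) (addrC (- _)) (addrAC y).
by rewrite (addrAC (y + a)).
Qed.

End simplex_projection.

(** * Minima of families with controlled increments *)

Lemma lipschitz_of_local (R : realType) (W : normedModType R) (g : R -> W) (a b K : R) :
  (forall t, a <= t -> t <= b -> exists2 d : R, 0 < d &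
     forall u v, a <= u -> u <= t -> t <= v -> v <= b -> t - d < u -> v < t + d ->
       `|g v - g u| <= K * (v - u)) ->
  forall u v, a <= u -> u <= v -> v <= b -> `|g v - g u| <= K * (v - u).
Proof.
move=> H u0 v0 au uv vb.
apply: (@real_induction R (fun c => `|g c - g u0| <= K * (c - u0)) u0 v0) => //.
  by rewrite !subrr normr0 mulr0.
move=> t ut tv; have [d d0 Hd] := H t (le_trans au ut) (le_trans tv vb).
exists d => // u v u0u ut' tv' vv0 du dv Hu.
have := Hd u v (le_trans au u0u) ut' tv' (le_trans vv0 vb) du dv => Huv.
have := ler_normD (g v - g u) (g u - g u0); rewrite addrA subrK; lra.
Qed.

Lemma powR_lipschitz (R : realType) (a b s : R) : 0 < a ->
  exists2 K : R, 0 <= K & forall u v, a <= u -> u <= v -> v <= b ->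
    `|v `^ s - u `^ s| <= K * (v - u).
Proof.
(* The power [t^(s - 1)] is monotone in [t], so one of its endpoint values dominates it; adding both
   avoids fixing the direction. *)
move=> a0; pose B := `|s| * (a `^ (s - 1) + b `^ (s - 1)).
have B0 : 0 <= B by rewrite mulr_ge0 // addr_ge0 // powR_ge0.
exists (B + 1); first lra.
apply: lipschitz_of_local => t ta tb.
have t0 : 0 < t by lra.
have [r r0 H] := is_derive_increment (is_derive1_powR s t0) ltr01.
exists r => // u v au ut tv vb ru rv.
have uv : u <= v by lra.
have := H u v ut tv ru rv.
have Dt : `|s * t `^ (s - 1)| <= B.
  rewrite normrM; apply: ler_wpM2l => //; rewrite ger0_norm ?powR_ge0 //.
  have a1 := powR_ge0 a (s - 1); have b1 := powR_ge0 b (s - 1).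
  have [s1|s1] := leP 1 s.
    have : t `^ (s - 1) <= b `^ (s - 1).
      by apply: ge0_ler_powR; rewrite ?nnegrE //; lra.
    lra.
  have : t `^ (s - 1) <= a `^ (s - 1).
    rewrite -(opprB 1 s) !powRN lef_pV2 ?posrE ?powR_gt0 //.
    by apply: ge0_ler_powR; rewrite ?nnegrE //; lra.
  lra.
move=> Hi; have := ler_normD (v `^ s - u `^ s - (v - u) *: (s * t `^ (s - 1)))
  ((v - u) *: (s * t `^ (s - 1))).
rewrite subrK normrZ (ger0_norm (_ : 0 <= v - u)) ?subr_ge0 // => Hn.
have : (v - u) * `|s * t `^ (s - 1)| <= (v - u) * B by apply: ler_wpM2l => //; lra.
lra.
Qed.

(** * Increments dominated by those of a reference function *)

Section increments_controlled.
Context {R : realType} {V : normedModType R} (w : R -> V) (a b : R).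

(** A Lipschitz condition relative to time and [w] jointly. With [w] the velocity it covers the
    energies, which inherit from [xd] absolute continuity only. *)
Definition controlled {W : normedModType R} (g : R -> W) : Prop :=
  exists2 K : R, 0 <= K & forall u v, a <= u -> u <= v -> v <= b ->
    `|g v - g u| <= K * ((v - u) + `|w v - w u|).

Lemma controlled_lipschitz {W : normedModType R} (g : R -> W) (K : R) : 0 <= K ->
  (forall u v, a <= u -> u <= v -> v <= b -> `|g v - g u| <= K * (v - u)) -> controlled g.
Proof.
move=> K0 H; exists K => // u v au uv vb; apply: le_trans (H u v au uv vb) _.
by apply: ler_wpM2l => //; rewrite lerDl.
Qed.

Lemma controlled_cst {W : normedModType R} (c : W) : controlled (fun=> c).
Proof.
by apply: (@controlled_lipschitz _ _ 0) => // u v _ _ _; rewrite subrr normr0 mul0r.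
Qed.

Lemma controlled_self : controlled w.
Proof.
by exists 1 => // u v au uv vb; rewrite mul1r lerDr subr_ge0.
Qed.

Lemma controlledD {W : normedModType R} (g h : R -> W) :
  controlled g -> controlled h -> controlled (fun t => g t + h t).
Proof.
move=> [K K0 HK] [L L0 HL]; exists (K + L); first exact: addr_ge0.
move=> u v au uv vb; rewrite opprD addrACA mulrDl.
by apply: le_trans (ler_normD _ _) _; apply: lerD; [exact: HK|exact: HL].
Qed.

Hypothesis wb : exists B : R, forall t, a <= t -> t <= b -> `|w t| <= B.

Lemma controlled_bounded {W : normedModType R} (g : R -> W) : controlled g ->
  exists2 B : R, 0 <= B & forall t, a <= t -> t <= b -> `|g t| <= B.
Proof.
move=> [K K0 HK]; have [B HB] := wb.
exists (`|g a| + K * (`|b - a| + 2 * `|B|)).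
  by rewrite addr_ge0 // mulr_ge0 // addr_ge0 // mulr_ge0.
move=> t ta tb; have := HK a t (lexx a) ta tb.
have := ler_normD (g t - g a) (g a); rewrite subrK.
have H : K * (t - a + `|w t - w a|) <= K * (`|b - a| + 2 * `|B|).
  apply: ler_wpM2l => //.
  have := HB t ta tb; have := HB a (lexx a) (le_trans ta tb).
  have := ler_normB (w t) (w a); have := ler_norm B; have := ler_norm (b - a); lra.
lra.
Qed.

(** The product rule for increments, each factor being bounded because [w] is. An abstract bilinear
    [m] serves both real products and inner products. *)
Lemma controlled_bilinear {U1 U2 W : normedModType R} (m : U1 -> U2 -> W)
    (g : R -> U1) (h : R -> U2) :
  (forall x y z, m (x - y) z = m x z - m y z) ->
  (forall x y z, m x (y - z) = m x y - m x z) ->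
  (forall x y, `|m x y| <= `|x| * `|y|) ->
  controlled g -> controlled h -> controlled (fun t => m (g t) (h t)).
Proof.
move=> mBl mBr mn cg ch.
have [Bg Bg0 HBg] := controlled_bounded cg; have [Bh Bh0 HBh] := controlled_bounded ch.
case: cg => K K0 HK; case: ch => L L0 HL.
exists (K * Bh + L * Bg); first by rewrite addr_ge0 // mulr_ge0.
move=> u v au uv vb; have av := le_trans au uv; have ub := le_trans uv vb.
have -> : m (g v) (h v) - m (g u) (h u) = m (g v - g u) (h v) + m (g u) (h v - h u).
  by rewrite mBl mBr addrA subrK.
apply: le_trans (ler_normD _ _) _; rewrite mulrDl; apply: lerD.
  apply: le_trans (mn _ _) _; rewrite mulrAC.
  by apply: ler_pM => //; [exact: HK|exact: HBh].
apply: le_trans (mn _ _) _; rewrite mulrC mulrAC.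
by apply: ler_pM => //; [exact: HL|exact: HBg].
Qed.

Lemma controlledM (g h : R -> R) :
  controlled g -> controlled h -> controlled (fun t => g t * h t).
Proof.
by apply: controlled_bilinear => *; rewrite ?mulrBl ?mulrBr ?normrM.
Qed.

End increments_controlled.

(** * Lower envelope of a finite family of functions *)

Section minimum_of_family.
Context {R : realType} (I : finType) (i0 : I) (G : I -> R -> R).

Let am t := [arg min_(i < i0) G i t]%O.
Let g t := G (am t) t.

Let g_le i t : g t <= G i t.
Proof. by rewrite /g /am; case: arg_minP => // j _; apply. Qed.

(** At [v] the envelope lies below a function active at [t]. At [u] it equals some [G i], and for
    [u] near [t] that [i] is active at [t], since inactive functions stay strictly above. Hence only
    active derivatives enter. *)
Lemma min_family_increment (D : I -> R) (t e : R) :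
  (forall i, is_derive t 1 (G i) (D i)) ->
  (forall i, G i t = g t -> D i <= 0) -> 0 < e ->
  exists2 d : R, 0 < d & forall u v, u <= t -> t <= v -> t - d < u -> v < t + d ->
    g v - g u <= e * (v - u).
Proof.
move=> GD D0 e0.
have H1 : \forall s \near t, forall i, `|G i s - G i t - (s - t) *: D i| <= e * `|s - t|.
  apply: (@filter_forall _ _ (fun i s => `|G i s - G i t - (s - t) *: D i| <= e * `|s - t|)
    (nbhs t)) => i.
  have [r r0 Hr] := is_derive_eps (GD i) e0.
  apply/nbhs_ballP; exists r => // s; rewrite /ball /= distrC; exact: Hr.
have Gc i : {for t, continuous (G i)}.
  by apply: differentiable_continuous; apply/derivable1_diffP; case: (GD i).
have H2 : \forall s \near t, forall i, G i t != g t -> g s < G i s.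
  apply: (@filter_forall _ _ (fun i s => G i t != g t -> g s < G i s) (nbhs t)) => i.
  have [_|ne] := eqVneq (G i t) (g t); first by near=> s.
  have gi : g t < G i t by rewrite lt_neqAle eq_sym ne g_le.
  pose m := (g t + G i t) / 2.
  have [m1 m2] : G (am t) t < m /\ m < G i t by split; rewrite /m -/(g t); lra.
  near=> s; move=> _; apply: (@lt_trans _ _ m).
    apply: le_lt_trans (g_le (am t) s) _.
    by near: s; apply: (cvgr_lt _ (Gc (am t))).
  by near: s; apply: (cvgr_gt _ (Gc i)).
have /nbhs_ballP[r /= r0 Hr] : nbhs t [set s |
    (forall i, `|G i s - G i t - (s - t) *: D i| <= e * `|s - t|) /\
    (forall i, G i t != g t -> g s < G i s)] by exact: filterI H1 H2.
exists r => // u v ut tv ru rv.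
have /Hr[Hu1 Hu2] : ball t r u by rewrite /ball /= ltr_norml; lra.
have /Hr[Hv1 _] : ball t r v by rewrite /ball /= ltr_norml; lra.
have act : G (am u) t = g t.
  by apply/eqP/negPn/negP => /Hu2; rewrite /g ltxx.
have Dv := D0 (am t) erefl; have Du := D0 _ act.
have := Hv1 (am t); rewrite (ger0_norm (_ : 0 <= v - t)) ?subr_ge0 //.
rewrite ler_norml => /andP[_]; rewrite /GRing.scale /= -/(g t) => hv.
have := Hu1 (am u); rewrite [X in e * X]distrC (ger0_norm (_ : 0 <= t - u)) ?subr_ge0 //.
rewrite act -/(g u) ler_norml => /andP[+ _]; rewrite /GRing.scale /= => hu.
have gv := g_le (am t) v.
have p1 : (v - t) * D (am t) <= 0 by rewrite mulr_ge0_le0 ?subr_ge0.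
have p2 : 0 <= (u - t) * D (am u) by rewrite mulr_le0 ?subr_le0.
lra.
Unshelve. all: by end_near. Qed.

Context {V : normedModType R} (w : R -> V) (a b C Mx : R) (N : set R).

(* Only the functions attaining the minimum at [t] have to be nonincreasing there, and
   only above the threshold [C]: the argument is run on [max (min_i G_i) Mx]. *)
Lemma min_family_bound :
  a <= b -> abs_cont_on w a b -> (@lebesgue_measure R).-negligible N ->
  (forall i, controlled w a b (G i)) ->
  (forall t, a <= t -> t <= b -> ~ N t -> exists D : I -> R,
     (forall i, is_derive t 1 (G i) (D i)) /\
     (forall i, (forall j, G i t <= G j t) -> C <= G i t -> D i <= 0)) ->
  C <= Mx -> (exists i, G i a <= Mx) -> exists i, G i b <= Mx.
Proof.
move=> ab wac N0 Gc GD CM [ia Ga].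
have /choice[K HK] : forall i, exists K : R, 0 <= K /\ forall u v, a <= u -> u <= v -> v <= b ->
    `|G i v - G i u| <= K * ((v - u) + `|w v - w u|).
  by move=> i; case: (Gc i) => K ? ?; exists K.
have K0 i : 0 <= K i by case: (HK i).
pose L := \sum_i K i.
have KL i : K i <= L by rewrite /L (bigD1 i) //= lerDl sumr_ge0.
have gK u v : a <= u -> u <= v -> v <= b -> g v - g u <= L * ((v - u) + `|w v - w u|).
  move=> au uv vb; have gv := g_le (am u) v.
  have [_ /(_ u v au uv vb) H] := HK (am u).
  have : K (am u) * (v - u + `|w v - w u|) <= L * (v - u + `|w v - w u|).
    by apply: ler_wpM2r (KL _); rewrite addr_ge0 ?subr_ge0.
  have := ler_norm (G (am u) v - G (am u) u).
  rewrite -/(g u) in H *; lra.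
have L0 : 0 <= L by apply: sumr_ge0.
have maxl (x y : R) : x <= Num.max x y by rewrite le_max lexx.
have maxr (x y : R) : y <= Num.max x y by rewrite le_max lexx orbT.
have : Num.max (g b) Mx <= Num.max (g a) Mx.
  apply: (ac_increment_le ab L0 wac (g := fun t => Num.max (g t) Mx) _ N0).
    move=> u v au uv vb; have := gK u v au uv vb.
    have : 0 <= L * (v - u + `|w v - w u|) by rewrite mulr_ge0 // addr_ge0 ?subr_ge0.
    have := maxl (g u) Mx; have := maxr (g u) Mx.
    by case: (leP (g v) Mx); lra.
  move=> t ta tb Nt e e0; have [D [GD1 GD2]] := GD t ta tb Nt.
  (* Above [Mx] the active derivatives are nonpositive because [C <= Mx]. Below [Mx] the envelope
     stays below it nearby, so the maximum equals [Mx] at [v]. *)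
  have [Mg|gM] := leP Mx (g t).
    have [|d d0 Hd] := min_family_increment GD1 _ e0.
      move=> i Gi; apply: GD2; last by rewrite Gi; lra.
      by move=> j; rewrite Gi.
    exists d => // u v au ut tv vb ru rv; have := Hd u v ut tv ru rv.
    have : 0 <= e * (v - u) by apply: mulr_ge0; lra.
    have := maxl (g u) Mx; have := maxr (g u) Mx.
    by case: (leP (g v) Mx); lra.
  have Gct : {for t, continuous (G (am t))}.
    by apply: differentiable_continuous; apply/derivable1_diffP; case: (GD1 (am t)).
  have /nbhs_ballP[r /= r0 Hr] : nbhs t [set s | G (am t) s < Mx] by exact: cvgr_lt Gct Mx gM.
  exists r => // u v au ut tv vb ru rv.
  have gv : g v < Mx.
    apply: le_lt_trans (g_le (am t) v) _; apply: Hr.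
    by rewrite /ball /= ltr_norml; lra.
  have : 0 <= e * (v - u) by apply: mulr_ge0; lra.
  have := maxr (g u) Mx; rewrite (max_idPr (ltW gv)); lra.
rewrite (max_idPr (le_trans (g_le ia a) Ga)) ge_max => /andP[gb _].
by exists (am b).
Qed.

End minimum_of_family.

(** * Lyapunov analysis of a trajectory *)

Lemma abs_cont_on_sub (R : realType) (V : normedModType R) (w : R -> V) (a b a' b' : R) :
  a <= a' -> b' <= b -> abs_cont_on w a b -> abs_cont_on w a' b'.
Proof.
move=> aa bb H e e0; have [d d0 Hd] := H e e0; exists d => // n l r H1 H2 H3.
by apply: Hd => // k /H1[? [? ?]]; split; [lra|split; lra].
Qed.

Lemma abs_cont_bounded (R : realType) (V : normedModType R) (w : R -> V) (a b : R) :
  a <= b -> abs_cont_on w a b ->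
  exists B : R, forall t, a <= t -> t <= b -> `|w t| <= B.
Proof.
move=> ab H; have [d d0 Hd] := H 1 ltr01.
have inc u v : a <= u -> u <= v -> v <= b -> v - u < d -> `|w v - w u| < 1.
  move=> au uv vb duv; have := Hd 1%N (fun=> u) (fun=> v); rewrite !big_ord1; apply => //.
  by move=> j [|k] //; case: j.
apply: (@real_induction R (fun c => exists B : R, forall t, a <= t -> t <= c -> `|w t| <= B)
  a b ab).
  by exists `|w a| => t ta tb; rewrite (_ : t = a) //; lra.
(* Half of [d] on each side of [t] keeps [v - u < d], so one step raises the bound by at most 1. *)
move=> t ta tb; exists (d / 2); first lra.
move=> u v au ut tv vb du dv [B HB]; exists (B + 1) => s sa sv.
have [su|us] := leP s u; first by have := HB s sa su; lra.
have := inc u s au (ltW us) (le_trans sv vb); have := HB u au (lexx u).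
have := ler_normD (w s - w u) (w u); rewrite subrK => h1 h2 h3.
have : `|w s - w u| < 1 by apply: h3; lra.
lra.
Qed.

Lemma is_deriveD_fun (R : realType) (f g : R -> R) (t a b : R) :
  is_derive t 1 f a -> is_derive t 1 g b -> is_derive t 1 (fun s => f s + g s) (a + b).
Proof. by move=> fa gb; exact: is_deriveD. Qed.

Lemma is_deriveM_fun (R : realType) (f g : R -> R) (t a b : R) :
  is_derive t 1 f a -> is_derive t 1 g b ->
  is_derive t 1 (fun s => f s * g s) (a * g t + f t * b).
Proof.
move=> fa gb; apply: (is_derive_eq (is_deriveM fa gb)).
by rewrite /GRing.scale /= addrC; congr (_ + _); exact: mulrC.
Qed.

(* [P], [rho] and [n] stand for [t^q], [beta/t^p] and the speed, [th] for [q t^(q-1)];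
   [al/3] is the weight of the cross term [S = <x - z, x'>], and [X = <x - z, x''>]. *)
Lemma energy_decay (R : realType) (al th a P n S X dW be rho Z2 C B : R) :
  0 < al -> 0 < P -> 0 <= n -> 0 <= a -> 0 <= th -> th <= al / 12 -> 0 <= B ->
  `|S| <= B * n -> 0 <= Z2 -> P * P * rho <= be ->
  dW <= - (al / P) * n ^+ 2 ->
  X <= - (al / P) * S - a + 2^-1 * n ^+ 2 + rho / 2 * Z2 ->
  C <= P * P * a + al / 3 * (P * S) ->
  be * Z2 + (al * B) ^+ 2 <= C ->
  2 * th * P * a + P * P * dW + al / 3 * (th * S + P * (n ^+ 2 + X)) <= 0.
Proof.
move=> al0 P0 n0 a0 th0 th1 B0 SB Z0 Prho dWle Xle CG Cbig.
(* Multiplying by [P] clears the divisions by [P]; everything is then expressed in [A], [y = P n]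
   and [c = P S]. *)
rewrite -(@pmulr_rle0 _ P) //.
set A := P * P * a in CG; pose y := P * n; pose c := P * S.
have A0 : 0 <= A by rewrite /A !mulr_ge0 // ltW.
have y0 : 0 <= y by rewrite /y mulr_ge0 // ltW.
have Pn : P != 0 by rewrite gt_eqF.
have cB : `|c| <= B * y.
  by rewrite /c /y normrM (gtr0_norm P0) mulrCA; apply: ler_wpM2l => //; exact: ltW.
have [c1 c2] : - (B * y) <= c /\ c <= B * y by move: cB; rewrite ler_norml => /andP[].
have dW' : P * P * P * dW <= - al * y ^+ 2.
  have -> : - al * y ^+ 2 = P * P * P * (- (al / P) * n ^+ 2) by rewrite /y; field.
  by apply: ler_wpM2l => //; rewrite !mulr_ge0 // ltW.
have X' : P * P * X <= - al * c - A + 2^-1 * y ^+ 2 + be / 2 * Z2.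
  have : P * P * X <= P * P * (- (al / P) * S - a + 2^-1 * n ^+ 2 + rho / 2 * Z2).
    by apply: ler_wpM2l => //; rewrite mulr_ge0 // ltW.
  have -> : P * P * (- (al / P) * S - a + 2^-1 * n ^+ 2 + rho / 2 * Z2) =
    - al * c - A + 2^-1 * y ^+ 2 + (P * P * rho) / 2 * Z2 by rewrite /c /y /A; field.
  have : (P * P * rho) / 2 * Z2 <= be / 2 * Z2 by apply: ler_wpM2r => //; lra.
  lra.
have -> : P * (2 * th * P * a + P * P * dW + al / 3 * (th * S + P * (n ^+ 2 + X))) =
  2 * th * A + P * P * P * dW + al / 3 * (th * c + y ^+ 2 + P * P * X).
  by rewrite /A /c /y; ring.
have hX : al / 3 * (P * P * X) <= al / 3 * (- al * c - A + 2^-1 * y ^+ 2 + be / 2 * Z2).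
  by apply: ler_wpM2l => //; lra.
(* The growth of [t^(2q)] uses up half of the term [- al / 3 * A] coming from [X]; the other half is
   played against the threshold [C]. *)
have hA : 2 * th * A <= al / 6 * A by apply: ler_wpM2r => //; lra.
have hc : (th - al) * c <= 13 / 12 * al * (B * y).
  have : (al - th) * (B * y) <= 13 / 12 * al * (B * y).
    by apply: ler_wpM2r; [rewrite mulr_ge0|lra].
  have : (al - th) * (- c) <= (al - th) * (B * y) by apply: ler_wpM2l; lra.
  lra.
have hc' : al / 3 * ((th - al) * c) <= al / 3 * (13 / 12 * al * (B * y)).
  by apply: ler_wpM2l => //; lra.
have hA' : al / 6 * (C - al / 3 * (B * y)) <= al / 6 * A.
  have : al / 3 * c <= al / 3 * (B * y) by apply: ler_wpM2l; lra.
  by rewrite -/c in CG => ?; apply: ler_wpM2l; lra.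
have hC : al / 6 * (be * Z2 + (al * B) ^+ 2) <= al / 6 * C.
  by apply: ler_wpM2l; lra.
pose k := al * B.
(* The [Z2] terms cancel, and what remains is at most [- al / 2 * (y^2 - 5/6 k y + k^2 / 3)].
   Completing the square suffices, as [25/144 < 1/3]. *)
have sq1 : 0 <= al * (y - 5 / 12 * k) ^+ 2 by rewrite mulr_ge0 ?sqr_ge0 // ltW.
have sq2 : 0 <= al * k ^+ 2 by rewrite mulr_ge0 ?sqr_ge0 // ltW.
have e1 : al * (y - 5 / 12 * k) ^+ 2 =
  al * y ^+ 2 - 5 / 6 * (al * al * (B * y)) + 25 / 144 * (al * k ^+ 2) by rewrite /k; field.
have e2 : al * (al * B) ^+ 2 = al * k ^+ 2 by [].
lra.
Qed.

Section trajectory.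
Context (R : realType) (V : normedModType R) (ip : V -> V -> R) (m : nat)
  (f : 'I_m -> V -> R) (grad : 'I_m -> V -> V)
  (alpha beta p q t0 : R) (x0 v0 : V) (x xd xdd : R -> V).
Hypotheses (hip : inner_product ip) (m0 : (0 < m)%N)
  (fconv : forall i, convex_fun (f i)) (fgrad : forall i, gradient_of ip (f i) (grad i))
  (glip : forall i, lipschitz_map (grad i))
  (t0_gt0 : 0 < t0) (alpha_gt0 : 0 < alpha) (beta_gt0 : 0 < beta)
  (q_gt0 : 0 < q) (q_le1 : q <= 1) (p_gt0 : 0 < p) (q_lt : q < p / 2) (p_le2 : p <= 2)
  (sol : mtrigs_solution grad alpha beta p q t0 x0 v0 x xd xdd).

Let x_t0 : x t0 = x0. Proof. by case: sol. Qed.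
Let xd_t0 : xd t0 = v0. Proof. by case: sol => _ []. Qed.
Let x_deriv t : t0 < t -> is_derive t 1 x (xd t).
Proof. by case: sol => _ [_ [H _]]; exact: H. Qed.
Let x_right : (fun h : R => h^-1 *: (x (t0 + h) - x t0)) @ at_right 0 --> xd t0.
Proof. by case: sol => _ [_ [_ []]]. Qed.
Let xd_ac T : t0 <= T -> abs_cont_on xd t0 T.
Proof. by case: sol => _ [_ [_ [_ [_ [H _]]]]]; exact: H. Qed.

(** A single null set collects the exceptional times of both almost-everywhere conditions, together
    with [t0], where no two-sided derivative is given. *)
Lemma trajectory_regular_ae : exists2 N : set R,
  (@lebesgue_measure R).-negligible N &
  forall t, t0 <= t -> ~ N t -> [/\ t0 < t, is_derive t 1 xd (xdd t) &
    alpha / t `^ q *: xd t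
     + proj0 [set y + (beta / t `^ p) *: x t + xdd t | y in conv_grads grad (x t)] = 0].
Proof.
case: sol => _ [_ [_ [_ [_ [_ [ae1 ae2]]]]]].
pose P1 t := t0 < t -> is_derive t 1 xd (xdd t).
pose P2 t := t0 <= t -> alpha / t `^ q *: xd t
     + proj0 [set y + (beta / t `^ p) *: x t + xdd t | y in conv_grads grad (x t)] = 0.
exists ([set t0] `|` (~` [set t | P1 t] `|` ~` [set t | P2 t])).
  apply: negligibleU; last by apply: negligibleU; [exact: ae1|exact: ae2].
  exists [set t0]; split => //; exact: lebesgue_measure_set1.
move=> t tt0 Nt.
have tn : t <> t0 by move=> E; apply: Nt; left.
have tlt : t0 < t by rewrite lt_neqAle tt0 andbT eq_sym; apply/eqP.
split => //.
  by have [] := pselect (P1 t); [exact|move=> n1; exfalso; apply: Nt; right; left].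
by have [] := pselect (P2 t); [exact|move=> n1; exfalso; apply: Nt; right; right].
Qed.

Lemma velocity_bounded T : t0 <= T -> exists B : R, forall t, t0 <= t -> t <= T -> `|xd t| <= B.
Proof. by move=> tT; apply: abs_cont_bounded => //; exact: xd_ac. Qed.

Lemma position_controlled T : t0 <= T -> controlled xd t0 T x.
Proof.
move=> tT; have [B HB] := velocity_bounded tT.
have B0 : 0 <= B by apply: le_trans (HB t0 (lexx _) tT).
apply: (@controlled_lipschitz _ _ _ _ _ _ _ (B + 1)); first lra.
(* At [t = t0] the straddling point [u] must be [t0] itself, so the right derivative is enough. *)
apply: lipschitz_of_local => t; rewrite le_eqVlt => /orP[/eqP<- _|tt tT'].
  have /cvgr_norm_lt/(_ (B + 1)) :
      (fun h : R => h^-1 *: (x (t0 + h) - x t0)) @ at_right 0 --> xd t0 by [].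
  have Bl : `|xd t0| < B + 1 by have := HB t0 (lexx _) tT; lra.
  move=> /(_ Bl)/nbhs_ballP[r /= r0 Hr].
  exists r => // u v t0u ut tv vT ru rv.
  have -> : u = t0 by lra.
  have [->|vt] := eqVneq v t0; first by rewrite !subrr normr0 mulr0.
  have v0' : 0 < v - t0 by rewrite subr_gt0 lt_neqAle eq_sym vt.
  have := Hr (v - t0); rewrite /ball /= sub0r normrN gtr0_norm // => /(_ _ v0').
  rewrite (addrC t0) subrK normrZ normfV gtr0_norm // ltr_pdivrMl // => H.
  by rewrite [_ * (v - t0)]mulrC ltW // H //; lra.
have [r r0 H] := is_derive_increment (x_deriv tt) ltr01.
exists r => // u v t0u ut tv vT ru rv; have := H u v ut tv ru rv => Hi.
have := ler_normD (x v - x u - (v - u) *: xd t) ((v - u) *: xd t).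
rewrite subrK normrZ (ger0_norm (_ : 0 <= v - u)); last by lra.
have : (v - u) * `|xd t| <= (v - u) * B by apply: ler_wpM2l; [lra|exact: HB (ltW tt) tT'].
lra.
Qed.

Lemma ip_controlled T (g h : R -> V) : t0 <= T -> controlled xd t0 T g ->
  controlled xd t0 T h -> controlled xd t0 T (fun t => ip (g t) (h t)).
Proof.
move=> tT; apply: controlled_bilinear.
- exact: velocity_bounded.
- exact: ipBl.
- exact: ipBr.
- exact: norm_ip_le.
Qed.

Lemma powR_controlled T s : controlled xd t0 T (fun t => t `^ s).
Proof.
have [K K0 H] := powR_lipschitz T s t0_gt0.
exact: (controlled_lipschitz _ K0).
Qed.

Lemma gradient_bounded i (r : R) : exists2 B : R, 0 <= B & forall y, `|y| <= r -> `|grad i y| <= B.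
Proof.
have [L HL] := glip i; exists (`|L| * `|r| + `|grad i 0|).
  by rewrite addr_ge0 // mulr_ge0.
move=> y yr; have := HL y 0; rewrite subr0 => H.
have := ler_normD (grad i y - grad i 0) (grad i 0); rewrite subrK.
have : L * `|y| <= `|L| * `|r|.
  apply: le_trans (ler_norm _) _; rewrite normrM normr_id.
  by apply: ler_wpM2l => //; apply: le_trans yr _; exact: ler_norm.
lra.
Qed.

(** On [[t0, T]] the trajectory stays in a ball, where the Lipschitz gradient is bounded; the
    gradient inequality in both directions does the rest. *)
Lemma objective_controlled i T : t0 <= T -> controlled xd t0 T (fun t => f i (x t)).
Proof.
move=> tT; have xc := position_controlled tT.
have [r r0 Hr] := controlled_bounded (velocity_bounded tT) xc.
have [B B0 HB] := gradient_bounded i r.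
case: xc => K K0 HK; exists (B * K); first exact: mulr_ge0.
move=> u v tu uv vT; apply: le_trans (_ : _ <= B * `|x v - x u|) _; last first.
  by rewrite -mulrA; apply: ler_wpM2l => //; exact: HK.
have h1 := gradient_dist hip (x v) (x u) (fconv i) (fgrad i).
have h2 := gradient_dist hip (x u) (x v) (fconv i) (fgrad i).
have g1 : `|grad i (x v)| * `|x v - x u| <= B * `|x v - x u|.
  by apply: ler_wpM2r => //; apply: HB; apply: Hr => //; lra.
have g2 : `|grad i (x u)| * `|x v - x u| <= B * `|x v - x u|.
  by apply: ler_wpM2r => //; apply: HB; apply: Hr => //; lra.
by rewrite (distrC (x u)) in h2; rewrite ler_norml; lra.
Qed.

(** This is [W_i], written with [ip] and the power [- p] so that the derivative rules apply term by
    term. *)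
Definition total_energy i t :=
  f i (x t) + beta / 2 * t `^ (- p) * ip (x t) (x t) + 2^-1 * ip (xd t) (xd t).

Definition total_energy_rate i t :=
  ip (grad i (x t)) (xd t)
  + (beta / 2 * (- p * t `^ (- p - 1)) * ip (x t) (x t)
     + beta / 2 * t `^ (- p) * (2 * ip (x t) (xd t)))
  + ip (xd t) (xdd t).

Lemma total_energy_controlled i T : t0 <= T -> controlled xd t0 T (total_energy i).
Proof.
move=> tT; have xc := position_controlled tT; have vb := velocity_bounded tT.
apply: controlledD; first apply: controlledD.
- exact: objective_controlled.
- apply: controlledM => //; last exact: ip_controlled.
  by apply: controlledM => //; [exact: controlled_cst|exact: powR_controlled].
- apply: controlledM => //; first exact: controlled_cst.
  by apply: ip_controlled => //; exact: controlled_self.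
Qed.

Lemma total_energy_derive i t : t0 < t -> is_derive t 1 xd (xdd t) ->
  is_derive t 1 (total_energy i) (total_energy_rate i t).
Proof.
move=> tt dv; have dx := x_deriv tt.
have tp : 0 < t := lt_trans t0_gt0 tt.
have d1 := gradient_chain (fgrad i) dx.
have d2 := is_derive_ip hip dx dx.
have d3 := is_derive_ip hip dv dv.
have d4 := is_derive1_powR (- p) tp.
apply: (is_derive_eq (is_deriveD_fun (is_deriveD_fun d1
  (is_deriveM_fun (is_deriveM_fun (is_derive_cst (beta / 2) t 1) d4) d2))
  (is_deriveM_fun (is_derive_cst (2^-1 : R) t 1) d3))).
rewrite /total_energy_rate /=.
by rewrite (ipC hip (xdd t)) (ipC hip (xd t) (x t)); field.
Qed.

(** The flow identifies the projection with [- (alpha / t^q) x']. Its variational inequality at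
    vertex [i] is divided by [alpha / t^q]; differentiating [beta / t^p] contributes a nonpositive
    term. *)
Lemma total_energy_rate_le i t : t0 < t ->
  alpha / t `^ q *: xd t
    + proj0 [set y + (beta / t `^ p) *: x t + xdd t | y in conv_grads grad (x t)] = 0 ->
  total_energy_rate i t <= - (alpha / t `^ q) * `|xd t| ^+ 2.
Proof.
move=> tt; have tp : 0 < t by exact: lt_trans tt.
have [mu [_ _ _]] := proj0_conv_grads hip grad (x t) ((beta / t `^ p) *: x t) (xdd t) m0.
set pr := proj0 _ => prle /eqP; rewrite addrC addr_eq0 => /eqP prE.
have k0 : 0 < alpha / t `^ q by rewrite divr_gt0 // powR_gt0.
have H : ip (xd t) (grad i (x t) + (beta / t `^ p) *: x t + xdd t)
    <= - (alpha / t `^ q) * `|xd t| ^+ 2.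
  move: (prle i); set y := _ + xdd t; rewrite prE !(ipNl hip) !(ipNr hip) opprK.
  rewrite !(ipZl hip) !(ipZr hip) (ipxx hip) => H.
  by rewrite -(ler_pM2l k0); lra.
move: H; rewrite !(ipDr hip) (ipZr hip) => H.
rewrite /total_energy_rate !powRN (ipC hip (grad i _)) (ipC hip (x t) (xd t)).
have : 0 <= beta / 2 * (p * t `^ (- p - 1)) * ip (x t) (x t).
  rewrite (ipxx hip); apply: mulr_ge0; last exact: sqr_ge0.
  by apply: mulr_ge0; [rewrite divr_ge0 // ltW|rewrite mulr_ge0 ?powR_ge0 // ltW].
have -> : beta / 2 * (t `^ p)^-1 * (2 * ip (xd t) (x t)) = beta / t `^ p * ip (xd t) (x t).
  by field; rewrite gt_eqF // powR_gt0.
lra.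
Qed.

(** The flow is paired with [x - z], the projection being a convex combination of the shifted
    gradients. Averaging the gradient inequalities with its weights [mu] brings in [a]. *)
Lemma cross_term_rate_le z a t : t0 < t ->
  alpha / t `^ q *: xd t
    + proj0 [set y + (beta / t `^ p) *: x t + xdd t | y in conv_grads grad (x t)] = 0 ->
  (forall i, a <= total_energy i t - f i z) ->
  ip (x t - z) (xdd t) <= - (alpha / t `^ q) * ip (x t - z) (xd t) - a
    + 2^-1 * `|xd t| ^+ 2 + beta / t `^ p / 2 * `|z| ^+ 2.
Proof.
move=> tt; have tp : 0 < t by exact: lt_trans tt.
have [mu [mu0 mu1 + _]] := proj0_conv_grads hip grad (x t) ((beta / t `^ p) *: x t) (xdd t) m0.
set pr := proj0 _ => prE /eqP; rewrite addrC addr_eq0 => /eqP prN aW.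
set k := alpha / t `^ q in prN *; set r := beta / t `^ p in prE *.
have r0 : 0 <= r by rewrite divr_ge0 ?powR_ge0 // ltW.
have E : ip (x t - z) pr = - k * ip (x t - z) (xd t) by rewrite prN (ipNr hip) (ipZr hip) mulNr.
move: E; rewrite prE !(ipDr hip) (ipZr hip) (ipC hip _ (\sum_(i < m) _)) (ip_suml hip).
have : a - r / 2 * `|x t| ^+ 2 - 2^-1 * `|xd t| ^+ 2 <=
    \sum_(i < m) mu i * ip (grad i (x t)) (x t - z).
  set c := a - _ - _; rewrite -[c]mul1r -mu1 mulr_suml; apply: ler_sum => i _.
  apply: ler_wpM2l => //; have := convex_gradient_le (x t) z (fconv i) (fgrad i).
  have := aW i; rewrite /total_energy !(ipxx hip) powRN /c.
  rewrite -(opprB (x t) z) (ipNr hip) /r.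
  have -> : beta / 2 * (t `^ p)^-1 = beta / t `^ p / 2 by ring.
  lra.
(* By polarization [r <x - z, x>] is [r / 2] times [|x|^2 + |x - z|^2 - |z|^2]; the [|x|^2] terms
   cancel and [|z|^2] is left. *)
have : 0 <= r / 2 * `|x t - z| ^+ 2 by rewrite mulr_ge0 ?sqr_ge0 // divr_ge0.
rewrite -(ipxx hip (x t - z)) !(ipBl hip, ipBr hip) !(ipxx hip) (ipC hip z (x t)).
lra.
Qed.

Lemma total_energy_nonincreasing i s t : t0 <= s -> s <= t ->
  total_energy i t <= total_energy i s.
Proof.
move=> ts st; have [N N0 HN] := trajectory_regular_ae.
have tt : t0 <= t by lra.
have Gc : forall j : 'I_1, controlled xd s t (total_energy i).
  move=> _; have [K K0 HK] := total_energy_controlled i tt.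
  by exists K => // u v su uv vt; apply: HK => //; lra.
(* A family with one member, the energy at [s] serving as threshold and as bound. *)
have [] // := @min_family_bound R 'I_1 ord0 (fun=> total_energy i) V xd s t
  (total_energy i s) (total_energy i s) N st _ N0 Gc.
- by apply: abs_cont_on_sub (xd_ac tt).
- move=> r sr rt Nr; have [tr dv eq] := HN r (le_trans ts sr) Nr.
  exists (fun=> total_energy_rate i r); split=> [_|_ _ _]; first exact: total_energy_derive.
  apply: le_trans (total_energy_rate_le i tr eq) _.
  by rewrite mulNr oppr_le0 mulr_ge0 ?sqr_ge0 // divr_ge0 ?powR_ge0 // ltW.
- by exists ord0.
Qed.

Definition lyapunov z i t :=
  t `^ q * t `^ q * (total_energy i t + - f i z)
  + alpha / 3 * (t `^ q * ip (x t - z) (xd t)).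

Lemma lyapunov_controlled z i T : t0 <= T -> controlled xd t0 T (lyapunov z i).
Proof.
move=> tT; have vb := velocity_bounded tT.
have cP := @powR_controlled T q.
apply: controlledD; apply: controlledM => //.
- exact: controlledM.
- by apply: controlledD; [exact: total_energy_controlled|exact: controlled_cst].
- exact: controlled_cst.
- apply: controlledM => //; apply: ip_controlled => //; last exact: controlled_self.
  by apply: controlledD; [exact: position_controlled|exact: controlled_cst].
Qed.

Lemma lyapunov_derive z i t : t0 < t -> is_derive t 1 xd (xdd t) ->
  is_derive t 1 (lyapunov z i)
    (2 * (q * t `^ (q - 1)) * t `^ q * (total_energy i t - f i z)
     + t `^ q * t `^ q * total_energy_rate i t
     + alpha / 3 * (q * t `^ (q - 1) * ip (x t - z) (xd t)
                    + t `^ q * (`|xd t| ^+ 2 + ip (x t - z) (xdd t)))).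
Proof.
move=> tt dv; have tp : 0 < t by exact: lt_trans tt.
have dP := is_derive1_powR q tp.
have dW := is_deriveD_fun (total_energy_derive i tt dv) (is_derive_cst (- f i z) t 1).
have dxz : is_derive t 1 (fun s => x s - z) (xd t - 0).
  by apply: is_deriveB; exact: x_deriv.
have dS := is_derive_ip hip dxz dv.
apply: (is_derive_eq (is_deriveD_fun (is_deriveM_fun (is_deriveM_fun dP dP) dW)
  (is_deriveM_fun (is_derive_cst (alpha / 3) t 1) (is_deriveM_fun dP dS)))).
by rewrite subr0 (ipxx hip (xd t)) /=; ring.
Qed.

(** Here [q < p / 2 <= 1] makes the exponent [q - 1] negative. The quantity is the derivative of
    [t^q], which the friction must absorb. *)
Lemma powR_decay_eventually (e : R) : 0 < e -> exists t1 : R,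
  [/\ 1 <= t1, t0 <= t1 & forall t, t1 <= t -> q * t `^ (q - 1) <= e].
Proof.
move=> e0; have q1 : 0 < 1 - q by move: q_lt p_le2; lra.
pose s := (e^-1) `^ (1 - q)^-1.
exists (Num.max 1 (Num.max t0 s)); split.
- by rewrite le_max lexx.
- by rewrite !le_max lexx orbT.
move=> t; rewrite !ge_max => /and3P[t1 tt0 ts].
have tp : 0 < t := lt_le_trans ltr01 t1.
have h : e^-1 <= t `^ (1 - q).
  have -> : e^-1 = s `^ (1 - q).
    by rewrite /s -powRrM mulVf ?gt_eqF // powRr1 // invr_ge0 ltW.
  by apply: ge0_ler_powR; rewrite ?nnegrE ?powR_ge0 //; lra.
rewrite -(opprB 1 q) powRN.
apply: le_trans (_ : 1 * (t `^ (1 - q))^-1 <= _).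
  by apply: ler_wpM2r => //; rewrite invr_ge0 powR_ge0.
by rewrite mul1r -(invrK e) lef_pV2 ?posrE ?powR_gt0 // invr_gt0.
Qed.

(** The condition [q < p / 2] makes [2q - p] negative, so the rescaled Tikhonov weight stays
    bounded. *)
Lemma powR_product_le t : 1 <= t -> t `^ q * t `^ q * (beta / t `^ p) <= beta.
Proof.
move=> t1; have tp : 0 < t by exact: lt_le_trans t1.
have tn : t != 0 by rewrite gt_eqF.
have -> : t `^ q * t `^ q * (beta / t `^ p) = beta * t `^ (q + q - p).
  by rewrite !powRD ?tn ?implybT // powRN; ring.
rewrite ger_pMr // -[leRHS](powRr0 t) ler_powR //; move: q_lt; lra.
Qed.

(** * Uniform decay rates along a bounded trajectory *)

Section bounded_trajectory.
Variables (M Z : R).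
Hypothesis x_bounded : forall t, t0 <= t -> `|x t| <= M.

Lemma lyapunov_bounded : 0 <= Z -> exists t1 C : R, [/\ 1 <= t1, t0 <= t1 &
  forall T z, t1 <= T -> `|z| <= Z -> (forall i, f i z <= f i (x T)) ->
    exists i, lyapunov z i T <= C].
Proof.
move=> Z0; have [t1 [t11 t01 Ht1]] := powR_decay_eventually (divr_gt0 alpha_gt0 (ltr0n R 12)).
have M0 : 0 <= M by apply: le_trans (x_bounded (lexx t0)).
pose B := M + Z; have B0 : 0 <= B by rewrite addr_ge0.
have xzB t z : t0 <= t -> `|z| <= Z -> `|x t - z| <= B.
  move=> tt zZ; apply: le_trans (ler_normB _ _) _; apply: lerD => //; exact: x_bounded.
pose C := beta * Z ^+ 2 + (alpha * B) ^+ 2.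
pose i0 := Ordinal m0; pose P1 := t1 `^ q.
(* Bounds the member [i0] at the starting time [t1]; the gradient inequality replaces [f i0 z] by
   quantities free of [z] and [T]. *)
pose C1 := P1 * P1 * (total_energy i0 t1 - f i0 (x t1) + `|grad i0 (x t1)| * B)
  + alpha / 3 * (P1 * (B * `|xd t1|)).
exists t1, (Num.max C C1); split => // T z t1T zZ fz.
have tT : t0 <= T by exact: le_trans t1T.
have [N N0 HN] := trajectory_regular_ae.
have Gc i : controlled xd t1 T (lyapunov z i).
  have [K K0 HK] := lyapunov_controlled z i tT.
  by exists K => // u v su uv vt; apply: HK => //; exact: le_trans su.
apply: (@min_family_bound R 'I_m i0 (lyapunov z) V xd t1 T C (Num.max C C1) N t1T _ N0 Gc).
- exact: abs_cont_on_sub t01 (lexx T) (xd_ac tT).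
- move=> t t1t tT' Nt; have t0t : t0 <= t by exact: le_trans t1t.
  have [tt dv eq] := HN t t0t Nt.
  eexists; split=> [i|i iact CG]; first exact: (lyapunov_derive z i tt dv).
  have tp : 0 < t := lt_trans t0_gt0 tt.
  have Pp : 0 < t `^ q by rewrite powR_gt0.
  set a := total_energy i t - f i z.
  (* All members share the cross term, so the active index also minimizes [W_j - f_j(z)]. *)
  have aj j : a <= total_energy j t - f j z.
    have := iact j; rewrite /lyapunov lerD2r ler_pM2l //.
    by rewrite mulr_gt0.
  apply: (@energy_decay R alpha (q * t `^ (q - 1)) a (t `^ q) `|xd t|
    (ip (x t - z) (xd t)) (ip (x t - z) (xdd t)) (total_energy_rate i t)
    beta (beta / t `^ p) (Z ^+ 2) C B) => //.
  (* Nonnegativity at every [t <= T] comes from the comparison at the final time [T], carried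
     backwards by the decreasing energy. *)
  + rewrite /a subr_ge0; apply: le_trans (fz i) _.
    apply: le_trans (total_energy_nonincreasing i t0t tT').
    rewrite /total_energy -addrA lerDl addr_ge0 //.
      by rewrite (ipxx hip) mulr_ge0 ?sqr_ge0 // mulr_ge0 ?powR_ge0 // divr_ge0 // ltW.
    by rewrite (ipxx hip) mulr_ge0 ?sqr_ge0 // invr_ge0.
  + by rewrite mulr_ge0 ?powR_ge0 // ltW.
  + exact: Ht1.
  + by apply: le_trans (norm_ip_le hip _ _) _; apply: ler_wpM2r => //; exact: xzB.
  + exact: sqr_ge0.
  + by apply: powR_product_le; exact: le_trans t1t.
  + exact: total_energy_rate_le.
  + have H := cross_term_rate_le tt eq aj; apply: le_trans H _.
    rewrite lerD2l; apply: ler_wpM2l; first by rewrite !divr_ge0 ?powR_ge0 // ltW.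
    by rewrite ler_pXn2r ?nnegrE.
- by rewrite le_max lexx.
- exists i0; rewrite le_max; apply/orP; right.
  rewrite /lyapunov -/P1 /C1; apply: lerD.
    apply: ler_wpM2l; first by rewrite mulr_ge0 ?powR_ge0.
    have := gradient_dist hip (x t1) z (fconv i0) (fgrad i0).
    have : `|grad i0 (x t1)| * `|x t1 - z| <= `|grad i0 (x t1)| * B.
      by apply: ler_wpM2l => //; exact: xzB.
    lra.
  apply: ler_wpM2l; first by rewrite divr_ge0 // ltW.
  apply: ler_wpM2l; first exact: powR_ge0.
  by apply: le_trans (ip_le hip _ _) _; apply: ler_wpM2r => //; exact: xzB.
Qed.

Let b0 i := f i x0 + (beta / (2 * t0 `^ p) * `|x0| ^+ 2 + 2^-1 * `|v0| ^+ 2).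

Lemma regularized_objective_le i t : t0 <= t ->
  f i (x t) + beta / (2 * t `^ p) * `|x t| ^+ 2 + 2^-1 * `|xd t| ^+ 2 <= b0 i.
Proof.
move=> tt; have := total_energy_nonincreasing i (lexx t0) tt.
rewrite /total_energy !(ipxx hip) x_t0 xd_t0 !powRN /b0.
have E (u : R) : beta / (2 * u) = beta / 2 * u^-1 by rewrite invfM mulrA.
by rewrite !E addrA.
Qed.

Hypothesis dominated : forall y, (forall i, f i y <= b0 i) ->
  exists2 z, `|z| <= Z & forall i, f i z <= f i y.

Lemma trajectory_rates : 0 <= Z -> exists t1 K : R, [/\ 1 <= t1, t0 <= t1, 0 <= K &
  forall T, t1 <= T -> T `^ q * `|xd T| <= K /\
    forall y, exists i, T `^ q * T `^ q * (f i (x T) - f i y) <= K].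
Proof.
move=> Z0; have [t1 [C [t11 t01 HC]]] := lyapunov_bounded Z0.
have M0 : 0 <= M by apply: le_trans (x_bounded (lexx t0)).
pose B := M + Z; have B0 : 0 <= B by rewrite addr_ge0.
have al0 := alpha_gt0.
have aB0 : 0 <= alpha * B by rewrite mulr_ge0 // ltW.
(* Chosen so that [y^2 / 2 <= |C| + (alpha B / 3) y] forces [y <= Y]; [K] then bounds both the speed
   and the objective gap. *)
pose Y := 1 + 2 * `|C| + alpha * B.
have Y1 : 1 <= Y by rewrite /Y; have := normr_ge0 C; lra.
pose K := Y + `|C| + alpha * B * Y.
have aBY : 0 <= alpha * B * Y by apply: mulr_ge0 => //; lra.
have K0 : 0 <= K by rewrite /K; have := normr_ge0 C; lra.
have below y T : t1 <= T -> (forall i, f i y <= f i (x T)) ->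
    T `^ q * `|xd T| <= Y /\ exists i, T `^ q * T `^ q * (f i (x T) - f i y) <= K.
  move=> t1T yx; have tT : t0 <= T by exact: le_trans t1T.
  have yb i : f i y <= b0 i.
    apply: le_trans (yx i) (le_trans _ (regularized_objective_le i tT)).
    rewrite -addrA lerDl addr_ge0 // mulr_ge0 ?sqr_ge0 ?invr_ge0 //.
    by rewrite divr_ge0 ?mulr_ge0 ?powR_ge0 // ltW.
  have [z zZ zy] := dominated yb.
  have [i] := HC T z t1T zZ (fun i => le_trans (zy i) (yx i)).
  set P := T `^ q; rewrite /lyapunov -/P.
  have P0 : 0 <= P by exact: powR_ge0.
  pose n := `|xd T|; pose d := f i (x T) - f i z.
  have d0 : 0 <= d by rewrite subr_ge0; exact: le_trans (zy i) (yx i).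
  have E1 : d + 2^-1 * n ^+ 2 <= total_energy i T - f i z.
    rewrite /total_energy !(ipxx hip) /d /n.
    have : 0 <= beta / 2 * T `^ (- p) * `|x T| ^+ 2.
      by rewrite mulr_ge0 ?sqr_ge0 // mulr_ge0 ?powR_ge0 // divr_ge0 // ltW.
    lra.
  have E2 : P * P * (d + 2^-1 * n ^+ 2) <= P * P * (total_energy i T - f i z).
    by apply: ler_wpM2l => //; exact: mulr_ge0.
  have n0 : 0 <= n by exact: normr_ge0.
  pose y' := P * n; have y0 : 0 <= y' by exact: mulr_ge0.
  have E3 : alpha / 3 * - (B * y') <= alpha / 3 * (P * ip (x T - z) (xd T)).
    apply: ler_wpM2l; first by rewrite divr_ge0 // ltW.
    rewrite /y' mulrCA -mulrN; apply: ler_wpM2l => //.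
    apply: le_trans (ip_ge hip _ _); rewrite lerN2; apply: ler_wpM2r => //.
    by apply: le_trans (ler_normB _ _) _; apply: lerD => //; exact: x_bounded.
  move=> HL; have Pd0 : 0 <= P * P * d by rewrite !mulr_ge0.
  have E4 : P * P * (d + 2^-1 * n ^+ 2) = P * P * d + 2^-1 * y' ^+ 2 by rewrite /y'; ring.
  have HL' : P * P * d + 2^-1 * y' ^+ 2 <= `|C| + alpha * B / 3 * y'.
    by have := ler_norm C; lra.
  have yY : y' <= Y.
    rewrite leNgt; apply/negP => Yy.
    have : Y * y' <= y' * y' by apply: ler_wpM2r => //; exact: ltW.
    have : `|C| * 1 <= `|C| * y' by apply: ler_wpM2l => //; lra.
    rewrite /Y expr2 in HL' *; have := mulr_ge0 aB0 y0; lra.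
  have aBy : alpha * B * y' <= alpha * B * Y by apply: ler_wpM2l.
  split=> //; exists i.
  have : P * P * (f i (x T) - f i y) <= P * P * d.
    by apply: ler_wpM2l; [exact: mulr_ge0|rewrite lerD2l lerN2; exact: zy].
  have := sqr_ge0 y'; rewrite /K; lra.
exists t1, K; split => // T t1T; split.
  (* The speed bound comes from the competitor [x T] itself. *)
  have [H _] := below (x T) T t1T (fun i => lexx _).
  by apply: le_trans H _; rewrite /K; have := normr_ge0 C; lra.
move=> y; have [yx|] := pselect (forall i, f i y <= f i (x T)).
  by have [] := below y T t1T yx.
(* If [y] does not dominate [x T], some component gap is negative and [K >= 0] suffices. *)
move=> /existsNP[i /negP]; rewrite -ltNge => xy; exists i.
apply: le_trans K0; rewrite mulr_ge0_le0 ?mulr_ge0 ?powR_ge0 // subr_le0 ltW //.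
Qed.

End bounded_trajectory.
End trajectory.

(** * Merit function and conclusion *)

Section merit_function.
Context {R : realType} {V : normedModType R} {m : nat}.
Implicit Types (f : 'I_m -> V -> R) (g h : 'I_m -> R).

Lemma emax_le_exists g h : (0 < m)%N -> (emax g <= emax h)%E -> exists i, g i <= h i.
Proof.
move=> m0 gh.
have [|i _ hi] := @eq_bigmax _ (\bar R) _ -oo%E (Ordinal m0) xpredT (fun i => (h i)%:E) isT.
  by move=> i _; rewrite leNye.
exists i; rewrite -lee_fin -hi; apply: le_trans gh; exact: le_bigmax.
Qed.

Lemma merit_ge0 f x : (0 <= merit f x)%E.
Proof.
apply: le_trans (_ : emin (fun i => (f i x - f i x)%R) <= _)%E.
  by apply: le_bigmin => // i _; rewrite subrr.
by apply: ereal_sup_ubound; exists x.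
Qed.

Lemma merit_le f x (k : R) : (forall y, exists i, f i x - f i y <= k) -> (merit f x <= k%:E)%E.
Proof.
move=> H; apply: ge_ereal_sup => _ [y _ <-]; have [i Hi] := H y.
by apply: (bigmin_inf i) => //; rewrite lee_fin.
Qed.

(** Optimality yields an index at which [z] is no worse than [u]; as [u] is no worse in [f], only
    the quadratic terms can account for it. *)
Lemma argmin_reg_obj_norm_le f (beta p t : R) (w : 'I_m -> R) (z u : V) :
  (0 < m)%N -> 0 < beta -> 0 < t -> argmin_set (reg_obj f beta p t) w z ->
  (forall i, f i u <= f i z) -> `|z| <= `|u|.
Proof.
move=> m0 beta0 t0 zmin uz.
have [i] := emax_le_exists m0 (zmin u); rewrite lerD2r /reg_obj => H.
have c0 : 0 < beta / (2 * t `^ p) by rewrite divr_gt0 // mulr_gt0 // powR_gt0.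
have : beta / (2 * t `^ p) * `|z| ^+ 2 <= beta / (2 * t `^ p) * `|u| ^+ 2.
  by have := uz i; lra.
by rewrite ler_pM2l // ler_pXn2r // nnegrE.
Qed.

Lemma argmin_reg_obj_le f (beta p t : R) (z x : V) :
  argmin_set (reg_obj f beta p t) (reg_obj f beta p t ^~ x) z ->
  forall i, reg_obj f beta p t i z <= reg_obj f beta p t i x.
Proof.
move=> zmin i; rewrite -subr_le0 -lee_fin.
apply: le_trans (_ : emax (fun i => (reg_obj f beta p t i z - reg_obj f beta p t i x)%R) <= _)%E.
  by apply: (bigmax_sup i).
apply: le_trans (zmin x) _; apply: bigmax_le => [|j _]; first by rewrite leNye.
by rewrite subrr.
Qed.

Lemma assumption_A3_dominated f (beta p t0 : R) (x0 v0 : V) :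
  assumption_A3 f beta p t0 x0 v0 -> exists2 Z : R, 0 <= Z & forall y,
    (forall i, f i y <= f i x0 + (beta / (2 * t0 `^ p) * `|x0| ^+ 2 + 2^-1 * `|v0| ^+ 2)) ->
    exists2 z, `|z| <= Z & forall i, f i z <= f i y.
Proof.
case; set b := fun i : 'I_m => _; set S := ereal_sup _ => ne Sfin.
(* The infimum over a fibre need not be attained; the extra 1 gives a strict inequality, hence an
   actual point [z] of the fibre. *)
exists (`|fine S| + 1); first by rewrite addr_ge0.
move=> y yb; have [y' [y'y y'P]] := ne y yb.
have y'S : LPw f b y' by split => // i; exact: le_trans (y'y i) (yb i).
have : (ereal_inf [set (`|z|)%:E | z in [set z | forall i, f i z = f i y']]
    < (`|fine S| + 1)%:E)%E.
  apply: le_lt_trans (_ : _ <= S)%E _; first by apply: ereal_sup_ubound; exists y'.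
  case: S Sfin => [r _| //|_]; last exact: ltNyr.
  by rewrite lte_fin /=; have := ler_norm r; lra.
move=> /ereal_inf_lt[_ [z zy' <-]]; rewrite lte_fin => /ltW zZ; exists z => // i.
by rewrite zy'; exact: y'y.
Qed.

End merit_function.

Unset Implicit Arguments.

Theorem mainTheorem12 (R : realType) (V : completeNormedModType R)
  (ip : V -> V -> R) (m : nat) (f : 'I_m -> V -> R) (grad : 'I_m -> V -> V)
  (alpha beta p q t0 : R) (x0 v0 : V) (x xd xdd : R -> V) :
  inner_product ip ->
  (0 < m)%N ->
  (forall i, convex_fun (f i)) ->
  (forall i, gradient_of ip (f i) (grad i)) ->
  (forall i, lipschitz_map (grad i)) ->
  0 < t0 -> 0 < alpha -> 0 < beta ->
  0 < q -> q <= 1 -> 0 < p -> p <= 2 -> q < p / 2 ->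
  assumption_A3 f beta p t0 x0 v0 ->
  assumption_A4 f ->
  mtrigs_solution grad alpha beta p q t0 x0 v0 x xd xdd ->
  (exists M : R, forall t, t0 <= t -> `|x t| <= M) ->
  [/\ (* (i) *)
      (forall lam : R, 0 < lam -> lam < alpha / 2 ->
         exists C : R, \forall t \near +oo,
           (`|energy f alpha beta p q q lam x xd t| <= C%:E)%E),
      (* (ii) *)
      (exists C : R, \forall t \near +oo,
         (`|merit (reg_obj f beta p t) (x t)| <= (C * t `^ (- (2 * q)))%:E)%E),
      (* (iii) *)
      (exists C : R, \forall t \near +oo,
         (`|merit f (x t)| <= (C * t `^ (- (2 * q)))%:E)%E),
      (* (iv) *)
      (exists C : R, \forall t \near +oo, `|x t - zpath f beta p x t| <= C) &
      (* (v) *)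
      (exists C : R, \forall t \near +oo, `|xd t| <= C * t `^ (- q))].
Proof.
move=> hip m0 fconv fgrad glip t00 al0 be0 q0 q1 p0 p2 qp A3 _ sol [M xM].
have [Z Z0 dom] := assumption_A3_dominated A3.
have M0 : 0 <= M by apply: le_trans (xM t0 (lexx t0)).
have [t1 [K [t11 t01 K0 rates]]] :=
  trajectory_rates hip m0 fconv fgrad glip t00 al0 be0 q0 q1 p0 qp p2 sol xM dom Z0.
have tp t : t1 <= t -> 0 < t by move=> ?; lra.
have powE t : t1 <= t -> t `^ (2 * q) = t `^ q * t `^ q.
  move=> tt; have tn : t != 0 by rewrite gt_eqF // tp.
  by rewrite -powRD ?tn ?implybT //; congr (_ `^ _); lra.
have scale t (d k : R) : t1 <= t -> t `^ q * t `^ q * d <= k -> d <= k * t `^ (- (2 * q)).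
  move=> tt H; rewrite powRN powE // ler_pdivlMr ?mulr_gt0 ?powR_gt0 ?tp //.
  by rewrite mulrC.
have meritK t : t1 <= t -> (merit f (x t) <= (K * t `^ (- (2 * q)))%:E)%E.
  move=> tt; apply: merit_le => y; have [_ /(_ y)[i Hi]] := rates t tt.
  by exists i; exact: scale.
(* The added term pays for the regularization at [x t]; the one at the competitor has a favourable
   sign. *)
pose K' := K + beta * M ^+ 2.
have K'0 : 0 <= K' by rewrite addr_ge0 // mulr_ge0 ?sqr_ge0 // ltW.
have rmeritK t : t1 <= t ->
    (merit (reg_obj f beta p t) (x t) <= (K' * t `^ (- (2 * q)))%:E)%E.
  move=> tt; apply: merit_le => y; have [_ /(_ y)[i Hi]] := rates t tt.
  exists i; apply: scale => //; rewrite /reg_obj /K'.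
  have tP := tp t tt; have Pp : 0 < t `^ p by rewrite powR_gt0.
  have -> : beta / (2 * t `^ p) = 2^-1 * (beta / t `^ p) by field; rewrite gt_eqF.
  set r := beta / t `^ p; set P := t `^ q * t `^ q in Hi *.
  have r0 : 0 <= r by rewrite divr_ge0 // ltW.
  have P0 : 0 <= P by rewrite mulr_ge0 // powR_ge0.
  have Pr : P * r <= beta.
    by apply: powR_product_le => //; exact: le_trans tt.
  have h1 : P * r * `|x t| ^+ 2 <= beta * M ^+ 2.
    apply: ler_pM => [||//|]; [exact: mulr_ge0|exact: sqr_ge0|].
    by rewrite ler_pXn2r ?nnegrE // xM //; lra.
  have h2 : 0 <= P * r * `|y| ^+ 2 by rewrite mulr_ge0 ?sqr_ge0 // mulr_ge0.
  have h3 : 0 <= P * r * `|x t| ^+ 2 by rewrite mulr_ge0 ?sqr_ge0 // mulr_ge0.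
  lra.
have zZ t : t1 <= t -> `|zpath f beta p x t| <= Z.
  move=> tt; rewrite /zpath /the_elt; set A := argmin_set _ _.
  have [[z Az]|nA] := pselect (exists z, A z); last first.
    rewrite xgetPN ?normr0 // => z Az; apply: nA; by exists z.
  have Ag : A (xget 0 A) by apply: xgetPex; exists z.
  set g := xget 0 A in Ag *.
  (* The minimizer lies in the level set of (A3), since its regularized values do not exceed those
     of [x t]. A point [u] of norm at most [Z] then dominates it, and optimality transfers the norm
     bound. *)
  have [|u uZ ug] := dom g.
    move=> i; apply: le_trans (regularized_objective_le hip m0 fconv fgrad glip
      t00 al0 be0 p0 sol i (le_trans t01 tt)).
    have : 0 <= beta / (2 * t `^ p) * `|g| ^+ 2.
      by rewrite mulr_ge0 ?sqr_ge0 // divr_ge0 ?mulr_ge0 ?powR_ge0 // ltW.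
    have := argmin_reg_obj_le Ag i; rewrite /reg_obj.
    have := sqr_ge0 `|xd t|; lra.
  apply: le_trans uZ; apply: (argmin_reg_obj_norm_le m0 be0 (tp t tt) Ag ug).
pose B := M + Z.
have B0 : 0 <= B by rewrite addr_ge0.
have xzB t : t1 <= t -> `|x t - zpath f beta p x t| <= B.
  move=> tt; apply: le_trans (ler_normB _ _) _; apply: lerD; last exact: zZ.
  by apply: xM; lra.
have t1oo : \forall t \near +oo, t1 <= t by apply: nbhs_pinfty_ge; exact: num_real.
split.
- move=> lam lam0 _; have l0 := ltW lam0; have a0 := ltW al0.
  pose C := K' + 2^-1 * (lam * B + K) ^+ 2 + lam / 2 * (q + alpha + 2 * lam) * B ^+ 2.
  exists C; apply: filterS t1oo => t tt; rewrite /energy.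
  have := rmeritK t tt; have := merit_ge0 (reg_obj f beta p t) (x t).
  (* The two merit bounds exclude the infinite values. *)
  case: merit => [k| |] //=; rewrite !lee_fin => k0 kK.
  have tP := tp t tt.
  have [vK _] := rates t tt; have xz := xzB t tt.
  set e := x t - zpath f beta p x t in xz *.
  have h1 : t `^ (2 * q) * k <= K'.
    have Pn : t `^ (2 * q) != 0 by rewrite gt_eqF // powR_gt0.
    have : t `^ (2 * q) * k <= t `^ (2 * q) * (K' * t `^ (- (2 * q))).
      by apply: ler_wpM2l => //; exact: powR_ge0.
    by rewrite powRN mulrCA divff // mulr1.
  have h1' : 0 <= t `^ (2 * q) * k by rewrite mulr_ge0 ?powR_ge0.
  have h2 : `|lam *: e + t `^ q *: xd t| ^+ 2 <= (lam * B + K) ^+ 2.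
    rewrite ler_pXn2r ?nnegrE ?addr_ge0 ?mulr_ge0 //.
    apply: le_trans (ler_normD _ _) _; rewrite !normrZ (gtr0_norm lam0).
    rewrite (ger0_norm (powR_ge0 _ _)); apply: lerD => //.
    by rewrite ler_pM2l.
  have h2' := sqr_ge0 `|lam *: e + t `^ q *: xd t|.
  rewrite subrr powRr0.
  have tq : t `^ (q - 1) <= 1.
    by rewrite -[leRHS](powRr0 t) ler_powR //; lra.
  have tq0 := powR_ge0 t (q - 1).
  have qt : 0 <= q * t `^ (q - 1) /\ q * t `^ (q - 1) <= q.
    by split; [rewrite mulr_ge0 // ltW|rewrite ger_pMr].
  (* With [r = q] the factor [t^(r - q)] is 1, and [t^(q - 1) <= 1] for [t >= 1], so the coefficient
     is bounded. *)
  pose c := q * t `^ (q - 1) + alpha * 1 - 2 * lam.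
  have ec : `|lam / 2 * c * `|e| ^+ 2| <= lam / 2 * (q + alpha + 2 * lam) * B ^+ 2.
    rewrite normrM normrX normr_id normrM (gtr0_norm (_ : 0 < lam / 2)) ?divr_gt0 //.
    apply: ler_pM; rewrite ?exprn_ge0 ?mulr_ge0 ?divr_ge0 //.
      by rewrite ler_pM2l ?divr_gt0 // /c ler_norml; lra.
    by rewrite ler_pXn2r ?nnegrE.
  rewrite -/c; move: ec; rewrite !ler_norml /C => /andP[e1 e2].
  lra.
- exists K'; apply: filterS t1oo => t tt.
  by rewrite gee0_abs ?merit_ge0 // rmeritK.
- exists K; apply: filterS t1oo => t tt.
  by rewrite gee0_abs ?merit_ge0 // meritK.
- by exists B; apply: filterS t1oo => t tt; exact: xzB.
- exists K; apply: filterS t1oo => t tt; have [vK _] := rates t tt.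
  by rewrite powRN ler_pdivlMr ?powR_gt0 ?tp // mulrC.
Qed.
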